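(* For each integer $m\geq 0$ there exists an integer $N_m>m$ such that every subset of $\{\zeta(3),\zeta(5),\dots,\zeta(2N_m+1)\}$ with $N_m-m$ elements contains at least one irrational number.
   Context: $\zeta$ denotes the Riemann zeta function, $\zeta(k)=\sum_{n=1}^\infty n^{-k}$. *)

(* Defs.v *)
From mathcomp Require Import all_boot all_order all_algebra.
From mathcomp Require Import all_classical all_reals all_analysis.

Set Implicit Arguments.
Unset Strict Implicit.
Unset Printing Implicit Defensive.

Import Order.TTheory GRing.Theory Num.Theory.
Import numFieldNormedType.Exports.

Local Open Scope classical_set_scope.
Local Open Scope ring_scope.

(* The summation index n >= 1 is written n.+1.  The series converges for
   k >= 2; for k <= 1 the value is meaningless. *)
Definition zeta (R : realType) (k : nat) : R :=
  limn (series (fun n : nat => (n.+1%:R ^+ k)^-1 : R)).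

Definition odd_zeta_values (R : realType) (N : nat) : set R :=
  [set zeta R (2 * j + 1)%N | j in [set j : nat | (1 <= j <= N)%N]].
Arguments odd_zeta_values R N : clear implicits.

(* Main.v *)
(** By contradiction, suppose that at most m of the numbers zeta(3), zeta(5), ..., zeta(s),
    with s = 2N+1, are irrational. Put D = 2^m, M = D r, and consider, for n a power of two, the
    rational function
      R(t) = n!^(s-2M) prod_(1 <= j <= M n) (D t - j) (D (t + n) + j) / (t (t+1) ... (t+n))^s.
    It is a product of s quotients of degree at most n by t (t+1) ... (t+n) whose partial
    fractions have integer numerators; so if d = lcm(1, ..., D n), the coefficient of
    1/(t+k)^i in R has denominator d^(s-i), up to a factor 2. Since R(-n-t) = -R(t) and
    t R(t) -> 0, the sums of R over q + j/2^l (q >= 0, 1 <= j <= 2^l) are rational combinations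
    of 1 and of 2^(l i) zeta(i), 3 <= i <= s odd. Let W(x) = sum_l w_l x^l be the product of the
    x - 2^i over the odd i with zeta(i) irrational: it has integer coefficients and degree at
    most m, so that sum_l w_l sum_(q, j) R(q + j/2^l) is a rational number, with denominator
    dividing a constant times d^s. As the zeros of R push the sums to t > r n, this number is
    O(b^n) with b d^(s/n) <= 1/2 if r = 2 * 4^D and s is large, because d <= 4^(D n).
    It is not zero: on the grid (1/D) Z the function R is unimodal and varies slowly near its
    maximum, so its sums over all residue classes are asymptotically equal, and the
    number is equivalent to W(2) times one of them, where W(2) <> 0.
    The idea of eliminating zeta values with sums over several denominators is due to
    Zudilin and Sprang; the crude choice of r makes sharp asymptotics unnecessary. *)

Require Import Defs.
From mathcomp Require Import all_boot all_order all_algebra.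
From mathcomp Require Import all_classical all_reals all_analysis.
From mathcomp Require Import zify ring lra.

Set Implicit Arguments.
Unset Strict Implicit.
Unset Printing Implicit Defensive.

Import Order.TTheory GRing.Theory Num.Theory.
Import numFieldNormedType.Exports.

Lemma big_ord_mul (T : Type) (idx : T) (op : Monoid.law idx) (M n : nat) (F : nat -> T) :
  \big[op/idx]_(j < M * n) F j = \big[op/idx]_(b < M) \big[op/idx]_(j < n) F (b * n + j).
Proof.
rewrite -(big_mkord xpredT F) big_nat_mul big_mkord; apply: eq_bigr => b _.
rewrite -[X in \big[_/_]_(X <= _ < _) _]add0n big_addn mulSn addnK big_mkord.
by apply: eq_bigr => j _; rewrite addnC.
Qed.

(** * The least common multiple of 1, ..., n *)

Definition lcm_upto (n : nat) : nat := \big[lcmn/1%N]_(1 <= i < n.+1) i.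

Lemma dvdn_lcm_upto n i : 0 < i <= n -> i %| lcm_upto n.
Proof.
move=> /andP[i0 ilen]; elim: n ilen => [|n IH] ilen; first by lia.
rewrite /lcm_upto big_nat_recr //= -/(lcm_upto n).
case: (ltngtP i n.+1) ilen => // [iltn _|-> _]; last exact: dvdn_lcmr.
by apply: dvdn_trans (dvdn_lcml _ _); apply: IH.
Qed.

Lemma lcm_upto_dvdn n m : (forall i, 0 < i <= n -> i %| m) -> lcm_upto n %| m.
Proof.
elim: n => [|n IH] h; first by rewrite /lcm_upto big_geq // dvd1n.
rewrite /lcm_upto big_nat_recr //= -/(lcm_upto n) dvdn_lcm; apply/andP; split.
  by apply: IH => i hi; apply: h; lia.
by apply: h; rewrite /= leqnn.
Qed.

Lemma lcm_upto_gt0 n : 0 < lcm_upto n.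
Proof.
elim: n => [|n IH]; first by rewrite /lcm_upto big_geq.
by rewrite /lcm_upto big_nat_recr //= lcmn_gt0 IH.
Qed.

(** By Legendre's formula the exponent of [p] in the binomial is the sum over k of floor(2n/p^k) - 2
    floor(n/p^k). No term is negative, and the term k = e is at least 1 because n < p^e <= 2n. *)
Lemma prime_dvd_central_bin p e n :
  prime p -> 0 < e -> n < p ^ e <= n.*2 -> p %| 'C(n.*2, n).
Proof.
move=> pp e0 /andP[h1 h2].
have n0 : 0 < n by lia.
have C0 : 0 < 'C(n.*2, n) by rewrite bin_gt0; lia.
rewrite -[p in p %| _]expn1 pfactor_dvdn //.
have e2n : e < n.*2.+1.
  by apply: (@leq_trans (p ^ e).+1); rewrite ltnS ?(leq_trans _ h2) // ltnW // ltn_expl // prime_gt1.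
have E : 'C(n.*2, n) * (n`! * n`!) = (n.*2)`!.
  have hn : n <= n.*2 by lia.
  by rewrite -(bin_fact hn) -addnn addnK.
have := congr1 (logn p) E.
rewrite !lognM ?muln_gt0 ?fact_gt0 //.
rewrite !logn_fact //.
(* The added terms vanish, since n < p^k for k > n; both sums then have the same range. *)
have -> : \sum_(1 <= k < n.+1) n %/ p ^ k = \sum_(1 <= k < n.*2.+1) n %/ p ^ k.
  rewrite (@big_cat_nat _ _ _ n.+1 1 n.*2.+1) //=; last by lia.
  rewrite [X in _ = _ + X]big_nat_cond [X in _ = _ + X]big1 ?addn0 // => k /andP[/andP[hk _] _].
  by rewrite divn_small // (leq_ltn_trans _ (ltn_expl k (prime_gt1 pp))) //; lia.
rewrite -big_split /=.
have F k : n %/ p ^ k + n %/ p ^ k <= n.*2 %/ p ^ k.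
  by rewrite leq_divRL ?expn_gt0 ?prime_gt0 // mulnDl -[in X in _ <= X]addnn leq_add // leq_divM.
have : \sum_(1 <= k < n.*2.+1) (n %/ p ^ k + n %/ p ^ k) <
       \sum_(1 <= k < n.*2.+1) n.*2 %/ p ^ k.
  rewrite (@big_cat_nat _ _ _ e 1 n.*2.+1) //=; last by lia.
  rewrite [X in _ < X](@big_cat_nat _ _ _ e 1 n.*2.+1) //=; last by lia.
  rewrite -addnS leq_add //; first by apply: leq_sum.
  rewrite big_ltn // [X in _ < X]big_ltn // -addSn leq_add //; last by apply: leq_sum.
  rewrite divn_small //= addn0 divn_gt0 ?expn_gt0 ?prime_gt0 //.
by lia.
Qed.

(** Compare prime powers. If p^e is the exact power of p in some i <= 2n, either p^e <= n, or
    p^(e-1) <= n divides the smaller lcm and the last factor p comes from the central binomial. *)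
Lemma lcm_upto_double n : lcm_upto n.*2 %| lcm_upto n * 'C(n.*2, n).
Proof.
apply: lcm_upto_dvdn => i /andP[i0 i2].
apply/dvdn_partP => // p; rewrite mem_primes => /and3P[pp _ pdi].
rewrite p_part; set e := logn p i.
have e0 : 0 < e by rewrite logn_gt0 mem_primes pp i0 pdi.
have pe : p ^ e <= i by rewrite dvdn_leq // pfactor_dvdnn.
case: (leqP (p ^ e) n) => hn.
  by apply: dvdn_mulr; apply: dvdn_lcm_upto; rewrite expn_gt0 prime_gt0.
rewrite -(prednK e0) expnSr; apply: dvdn_mul; last first.
  by apply: (prime_dvd_central_bin pp e0); rewrite hn; lia.
apply: dvdn_lcm_upto; rewrite expn_gt0 prime_gt0 //=.
have : p ^ e.-1 * p <= n.*2 by rewrite -expnSr prednK //; lia.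
have := prime_gt1 pp; set q := p ^ _; nia.
Qed.

(** Doubling n costs at most a factor C(2n, n) <= 4^n, which is exactly what the bound allows. This
    is why [n] is later a power of two. *)
Lemma lcm_upto_pow2 k : lcm_upto (2 ^ k) <= 4 ^ (2 ^ k).
Proof.
elim: k => [|k IH]; first by rewrite /lcm_upto big_nat1.
rewrite expnS mul2n; apply: (leq_trans (dvdn_leq _ (lcm_upto_double _))).
  by rewrite muln_gt0 lcm_upto_gt0 bin_gt0; lia.
rewrite -[in X in _ <= X]addnn expnD leq_mul //.
have -> : 4 ^ 2 ^ k = 2 ^ (2 ^ k).*2 by rewrite -mul2n expnM.
have {1}-> : 2 ^ (2 ^ k).*2 = \sum_(i < (2 ^ k).*2.+1) 'C((2 ^ k).*2, i).
  by rewrite -[2]/(1+1) expnDn; apply: eq_bigr => i _; rewrite !exp1n !muln1.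
have hlt : 2 ^ k < (2 ^ k).*2.+1 by lia.
by rewrite (bigD1 (Ordinal hlt)) //= leq_addr.
Qed.

Local Open Scope ring_scope.

(** * Partial fractions with controlled denominators *)

(* [a i k] is the numerator of 1 / (t + k)^(i + 1): the row index is one less than the exponent. *)
Definition pfrac (R : fieldType) (s n : nat) (a : nat -> nat -> R) (t : R) : R :=
  \sum_(i < s) \sum_(k < n.+1) a i k / (t + k%:R) ^+ i.+1.

Definition off_poles (R : fieldType) (n : nat) (t : R) : Prop :=
  forall k, (k <= n)%N -> t + k%:R != 0.

(** Order and denominator are weighted together: the numerator over (t + k)^(i+1) may have
    denominator d^(s-i-1), so that multiplying by a function of class 1 raises [s] by one. The
    identity is restricted to points off the poles, since at a pole a division by zero returns 0. *)
Definition pfrac_class (R : archiRealFieldType) (d : R) (n s : nat) (f : R -> R) : Prop :=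
  exists2 a : nat -> nat -> R,
    forall i k, (i < s)%N -> d ^+ (s - i.+1) * a i k \is a Num.int &
    forall t, off_poles n t -> f t = pfrac s n a t.

Section PartialFractions.
Variables (R : archiRealFieldType) (d : R) (n : nat).
Hypothesis d_int : d \is a Num.int.
Hypothesis d_div : forall j, (0 < j <= n)%N -> d / j%:R \is a Num.int.

Local Notation G := (pfrac_class d n).

Lemma pfrac_class_ext s f g :
  (forall t, off_poles n t -> f t = g t) -> G s f -> G s g.
Proof. by move=> fg [a ia fa]; exists a => // t ht; rewrite -fg // fa. Qed.

Lemma pfrac_class0 s : G s (fun=> 0).
Proof.
exists (fun _ _ => 0) => [i k _|t _]; first by rewrite mulr0 int_num0.
by rewrite /pfrac big1 // => i _; rewrite big1 // => k _; rewrite mul0r.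
Qed.

Lemma pfrac_classD s f g : G s f -> G s g -> G s (fun t => f t + g t).
Proof.
move=> [a ia fa] [b ib gb]; exists (fun i k => a i k + b i k) => [i k h|t ht].
  by rewrite mulrDr rpredD ?ia ?ib.
rewrite fa // gb // /pfrac -big_split; apply: eq_bigr => i _.
by rewrite -big_split; apply: eq_bigr => k _; rewrite mulrDl.
Qed.

Lemma pfrac_class_sum s m (F : nat -> R -> R) :
  (forall i, (i < m)%N -> G s (F i)) -> G s (fun t => \sum_(i < m) F i t).
Proof.
elim: m => [|m IH] h.
  by apply: pfrac_class_ext (pfrac_class0 s) => t _; rewrite big_ord0.
apply: (@pfrac_class_ext _ (fun t => \sum_(i < m) F i t + F m t)).
  by move=> t _; rewrite big_ord_recr.
by apply: pfrac_classD; [apply: IH => i hi; apply: h; lia|apply: h].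
Qed.

(** A factor with denominator d^e is paid for by raising the allowed order by [e]; the new rows are
    filled with zeros. *)
Lemma pfrac_class_scale s e q f :
  d ^+ e * q \is a Num.int -> G s f -> G (s + e) (fun t => q * f t).
Proof.
move=> iq [a ia fa]; exists (fun i k => if (i < s)%N then q * a i k else 0).
  move=> i k h; case: ifP => his; last by rewrite mulr0 int_num0.
  have -> : (s + e - i.+1 = e + (s - i.+1))%N by lia.
  by rewrite exprD mulrACA rpredM // ia.
move=> t ht; rewrite fa // /pfrac big_distrr /= (big_ord_widen (s + e)
  (fun i => q * \sum_(k < n.+1) a i k / (t + k%:R) ^+ i.+1)) ?leq_addr //.
rewrite big_mkcond /=; apply: eq_bigr => i _; case: ifP => _.
  by rewrite big_distrr /=; apply: eq_bigr => k _; rewrite mulrA.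
by rewrite big1 // => k _; rewrite mul0r.
Qed.

Lemma pfrac_class_simple i k0 : (k0 <= n)%N -> G i.+1 (fun t => (t + k0%:R) ^- i.+1).
Proof.
move=> hk; exists (fun j k => ((j == i) && (k == k0))%:R) => [j k _|t ht].
  by rewrite rpredM ?natr_int ?rpredX.
have hk' : (k0 < n.+1)%N by [].
rewrite /pfrac (bigD1 (ord_max : 'I_i.+1)) //= (bigD1 (Ordinal hk')) //= !eqxx /=.
rewrite mul1r big1 ?addr0 => [|k hk0]; last first.
  by rewrite -val_eqE /= in hk0; rewrite (negbTE hk0) mul0r.
rewrite big1 ?addr0 // => j hj; rewrite -val_eqE /= in hj; rewrite (negbTE hj).
by rewrite big1 // => k _; rewrite mul0r.
Qed.

(** Induction on [i], by 1/((t+k)^(i+1) (t+k0)) = (1/(k0-k)) (1/(t+k)^(i+1) - 1/((t+k)^i (t+k0))).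
    Each step divides by a nonzero difference of absolute value at most [n], which one factor [d]
    clears. *)
Lemma pfrac_class_simpleM i k k0 : (k <= n)%N -> (k0 <= n)%N ->
  G i.+1 (fun t => (t + k%:R) ^- i / (t + k0%:R)).
Proof.
move=> hk hk0; have [<-|kk] := eqVneq k k0.
  apply: pfrac_class_ext (pfrac_class_simple i hk) => t ht.
  by rewrite exprSr invfM mulrC.
elim: i => [|i IH].
  apply: pfrac_class_ext (pfrac_class_simple 0 hk0) => t ht.
  by rewrite expr0 invr1 mul1r expr1.
have kr : k%:R - k0%:R != 0 :> R by rewrite subr_eq0 eqr_nat.
set q : R := (k0%:R - k%:R)^-1.
have iq : d ^+ 1 * q \is a Num.int.
  rewrite expr1 /q; case: (ltnP k k0) => h.
    by rewrite -natrB ?(ltnW h) // d_div //; lia.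
  by rewrite -opprB -natrB // invrN mulrN rpredN d_div //; lia.
have h1 : G i.+1 (fun t => (t + k%:R) ^- i.+1 + - 1 * ((t + k%:R) ^- i / (t + k0%:R))).
  apply: pfrac_classD; first exact: pfrac_class_simple.
  rewrite -[i.+1]addn0; apply: pfrac_class_scale => //.
  by rewrite expr0 mul1r rpredN int_num1.
have := pfrac_class_scale iq h1; rewrite addn1; apply: pfrac_class_ext => t ht.
rewrite /q exprSr invfM; have := ht _ hk; have := ht _ hk0.
have : (t + k%:R)^+i != 0 by rewrite expf_neq0 // ht.
move: ((t + k%:R)^+i) => z hz h0 hk1.
by field; rewrite hz h0 hk1 -opprB oppr_eq0 kr.
Qed.

Lemma pfrac_class_divM s f k0 : (k0 <= n)%N ->
  G s f -> G s.+1 (fun t => f t / (t + k0%:R)).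
Proof.
move=> hk0 [a ia fa].
apply: (@pfrac_class_ext _ (fun t => \sum_(i < s) \sum_(k < n.+1)
   a i k * ((t + k%:R) ^- i.+1 / (t + k0%:R)))).
  move=> t ht; rewrite fa // /pfrac big_distrl /=; apply: eq_bigr => i _.
  by rewrite big_distrl /=; apply: eq_bigr => k _; rewrite mulrA.
apply: (@pfrac_class_sum _ _ (fun i t => \sum_(k < n.+1)
   a i k * ((t + k%:R) ^- i.+1 / (t + k0%:R)))) => i hi.
apply: (@pfrac_class_sum _ _ (fun k t =>
   a i k * ((t + k%:R) ^- i.+1 / (t + k0%:R)))) => k hk.
have -> : s.+1 = (i.+2 + (s - i.+1))%N by lia.
by apply: pfrac_class_scale; [exact: ia|exact: pfrac_class_simpleM].
Qed.

Lemma pfrac_classM s f g : G s f -> G 1 g -> G s.+1 (fun t => f t * g t).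
Proof.
move=> Gf [b ib gb].
apply: (@pfrac_class_ext _ (fun t => \sum_(k < n.+1) b 0%N k * (f t / (t + k%:R)))).
  move=> t ht; rewrite gb // /pfrac big_ord1 big_distrr /=; apply: eq_bigr => k _.
  by rewrite expr1 mulrCA.
apply: (@pfrac_class_sum _ _ (fun k t => b 0%N k * (f t / (t + k%:R)))) => k hk.
rewrite -[s.+1]addn0; apply: pfrac_class_scale; last exact: pfrac_class_divM.
by have := ib 0%N k isT; rewrite subnn.
Qed.

Lemma pfrac_class_prod s (F : nat -> R -> R) : (0 < s)%N ->
  (forall i, (i < s)%N -> G 1 (F i)) -> G s (fun t => \prod_(i < s) F i t).
Proof.
case: s => // s _; elim: s => [|s IH] h.
  by apply: pfrac_class_ext (h 0%N _) => // t _; rewrite big_ord1.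
apply: (@pfrac_class_ext _ (fun t => (\prod_(i < s.+1) F i t) * F s.+1 t)).
  by move=> t _; rewrite [RHS]big_ord_recr.
by apply: pfrac_classM; [apply: IH => i hi; apply: h; lia|apply: h].
Qed.

(** This is the derivative of t (t+1) ... (t+n) at -k, the denominator in Lagrange interpolation at
    0, -1, ..., -n. *)
Lemma prod_node_diff k : (k <= n)%N ->
  \prod_(l < n.+1 | l != k :> nat) (l%:R - k%:R) = (-1) ^+ k * (k`! * (n - k)`!)%:R :> R.
Proof.
move=> hk; rewrite -(big_mkord (fun l => l != k) (fun l => l%:R - k%:R : R)).
rewrite (@big_cat_nat _ _ _ k 0 n.+1) //=; last by lia.
rewrite [X in _ * X]big_ltn_cond ?ltnS // eqxx /= natrM mulrA; congr (_ * _); last first.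
  rewrite fact_prod natr_prod [RHS]big_add1 -[X in \prod_(X <= _ < _ | _) _]add0n big_addn.
  have -> : (n.+1 - k.+1 = n - k)%N by lia.
  rewrite big_nat_cond [RHS]big_nat_cond; apply: eq_big => [l|l _].
    by have -> : (l + k.+1 != k)%N by lia; rewrite !andbT.
  by rewrite -natrB; [congr _%:R|]; lia.
have -> : (-1) ^+ k = \prod_(0 <= l < k) (-1) :> R by rewrite prodr_const_nat subn0.
rewrite fact_prod natr_prod big_add1 /= [X in _ * X]big_nat_rev -big_split /=.
rewrite big_nat_cond [RHS]big_nat_cond; apply: eq_big => [l|l /andP[/andP[_ hl] _]].
  by rewrite andbT; case: (ltnP l k) => //= h; lia.
rewrite mulN1r add0n -opprB -natrB; last by lia.
by congr (- _%:R); lia.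
Qed.

(** Lagrange interpolation at 0, -1, ..., -n: the numerator over t + k is p(-k) / ((-1)^k k!
    (n-k)!), which equals (-1)^k C(n, k) p(-k) / n! and so is an integer. *)
Lemma pfrac_class_block (p : {poly R}) : (size p <= n.+1)%N ->
  (forall k, (k <= n)%N -> p.[- k%:R] / n`!%:R \is a Num.int) ->
  G 1 (fun t => p.[t] / \prod_(k < n.+1) (t + k%:R)).
Proof.
move=> sp ip.
pose b k := if (k <= n)%N then p.[- k%:R] / ((-1) ^+ k * (k`! * (n - k)`!)%:R) else 0 : R.
have fne k : (k`! * (n - k)`!)%:R != 0 :> R.
  by rewrite pnatr_eq0 -lt0n muln_gt0 !fact_gt0.
exists (fun _ k => b k) => [i k|t ht].
  case: i => // _; rewrite subnn expr0 mul1r /b; case: (leqP k n) => hk; last first.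
    exact: int_num0.
  have -> : p.[- k%:R] / ((-1) ^+ k * (k`! * (n - k)`!)%:R) =
     (-1) ^+ k * ('C(n, k)%:R * (p.[- k%:R] / n`!%:R)).
    rewrite -(bin_fact hk) [in RHS]natrM -signr_odd.
    have h2 : 'C(n, k)%:R != 0 :> R by rewrite pnatr_eq0 -lt0n bin_gt0.
    move: (fne k); move: (_ * _)%:R => z h1.
    move: h2; move: 'C(_, _)%:R => c h2.
    move: p.[_] => v.
    by case: (odd k); rewrite /= ?expr1 ?expr0 ?mulN1r ?mul1r; field; rewrite h1 h2.
  apply: rpredM; first by rewrite rpredX // rpredN int_num1.
  by apply: rpredM; [exact: natr_int|exact: ip].
pose Q (k : 'I_n.+1) : {poly R} := \prod_(l < n.+1 | l != k) ('X + l%:R%:P).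
have sQ k : (size (Q k) <= n.+1)%N.
  rewrite /Q (eq_bigr (fun l : 'I_n.+1 => 'X - (- l%:R)%:P)) => [|l _]; last first.
    by rewrite polyCN opprK.
  rewrite -big_filter size_prod_XsubC size_filter.
  by rewrite -sum1_count sum1_card cardC1 card_ord.
have Qv (j k : 'I_n.+1) : (Q k).[- j%:R] =
    if j == k then (-1) ^+ k * (k`! * (n - k)`!)%:R else 0.
  rewrite /Q horner_prod; case: eqVneq => [->|jk].
    have hk : (k <= n)%N by rewrite -ltnS.
    rewrite -(prod_node_diff hk); apply: eq_bigr => l _.
    by rewrite hornerD hornerX hornerC addrC.
  by rewrite (bigD1 j) //= !hornerE addNr mul0r.
(* The difference has size at most n + 1 and vanishes at the n + 1 nodes. *)
have pE : p - \sum_(k < n.+1) b k *: Q k = 0.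
  pose rs : seq R := [seq - (val j)%:R | j <- enum 'I_n.+1].
  apply: (roots_geq_poly_eq0 (rs := rs)).
  - apply/allP => _ /mapP [j _ ->]; rewrite /root hornerD hornerN horner_sum (bigD1 j) //=.
    rewrite hornerZ Qv eqxx big1 => [|k kj]; last first.
      by rewrite hornerZ Qv eq_sym (negbTE kj) mulr0.
    have hj : (j <= n)%N by rewrite -ltnS.
    rewrite addr0 /b hj divfK ?subrr //.
    by rewrite mulf_neq0 ?fne // signr_eq0.
  - rewrite map_inj_uniq ?enum_uniq // => x y /oppr_inj /eqP.
    by rewrite eqr_nat => /eqP /val_inj.
  - rewrite size_map size_enum_ord (leq_trans (size_polyD _ _)) // geq_max sp size_polyN.
    rewrite (leq_trans (size_sum _ _ _)) //; apply/bigmax_leqP => k _.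
    by rewrite (leq_trans (size_scale_leq _ _)).
rewrite /pfrac big_ord1 -[p](subrK (\sum_(k < n.+1) b k *: Q k)) pE add0r horner_sum.
rewrite big_distrl /=; apply: eq_bigr => k _; rewrite hornerZ expr1 /Q horner_prod.
rewrite [X in _ / X](bigD1 k) //= -mulrA; congr (_ * _).
have -> : \prod_(l < n.+1 | l != k) ('X + l%:R%:P).[t] = \prod_(l < n.+1 | l != k) (t + l%:R) :> R.
  by apply: eq_bigr => l _; rewrite !hornerE.
have h1 : t + k%:R != 0 by rewrite ht // -ltnS.
have : \prod_(l < n.+1 | l != k) (t + l%:R) != 0.
  by apply/prodf_neq0 => l _; rewrite ht // -ltnS.
by move: (\prod_(_ < _ | _) _) => z hz; field; rewrite hz h1.
Qed.
End PartialFractions.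

(** * The rational function *)

Definition rat_fun (R : fieldType) (D M n s : nat) (t : R) : R :=
  n`!%:R ^+ (s - M.*2) *
  (\prod_(j < M * n) ((D%:R * t - j.+1%:R) * (D%:R * (t + n%:R) + j.+1%:R))) /
  (\prod_(k < n.+1) (t + k%:R)) ^+ s.

Lemma size_prod_linear (R : idomainType) n (F : nat -> {poly R}) :
  (forall j, (size (F j) <= 2)%N) -> (size (\prod_(j < n) F j)%R <= n.+1)%N.
Proof.
move=> h; elim: n => [|n IH]; first by rewrite big_ord0 size_poly1.
rewrite big_ord_recr /= (leq_trans (size_polyMleq _ _)) //.
by have := leq_add IH (h n); rewrite addn2; case: (_ + _)%N.
Qed.

Lemma size_linear (R : idomainType) (a b : R) : (size (a *: 'X + b%:P)%R <= 2)%N.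
Proof.
rewrite (leq_trans (size_polyD _ _)) // geq_max (leq_trans (size_scale_leq _ _)) ?size_polyX //.
by rewrite (leq_trans (size_polyC_leq1 _)).
Qed.

Lemma prod_consecutive x n :
  (\prod_(j < n) (x + j.+1) = n`! * 'C(x + n, n))%N.
Proof.
rewrite mulnC bin_ffact ffact_prod -(big_mkord xpredT (fun j => x + j.+1)%N).
rewrite big_nat_rev /= big_mkord; apply: eq_bigr => j _.
by have := ltn_ord j; lia.
Qed.

Section RatFun.
Variables (R : archiRealFieldType) (d : R) (D M n s : nat).

(** Cuts the numerator into [s] polynomials of degree at most [n]: [M] blocks for the zeros j/D, [M]
    blocks for their mirror images, and s - 2M constants n!. One block goes over each copy of t
    (t+1) ... (t+n). *)
Definition rat_block (i : nat) : {poly R} :=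
  if (i < M)%N then \prod_(j < n) (D%:R *: 'X + (- (i * n + j).+1%:R)%:P)
  else if (i < M.*2)%N then
    \prod_(j < n) (D%:R *: 'X + (D * n + ((i - M) * n + j).+1)%:R%:P)
  else n`!%:R%:P.

Lemma rat_block_prod (t : R) : (M.*2 <= s)%N ->
  \prod_(i < s) ((rat_block i).[t] / \prod_(k < n.+1) (t + k%:R)) = rat_fun D M n s t.
Proof.
move=> Ms; rewrite big_split /= prodr_const card_ord exprVn; congr (_ / _).
rewrite -(big_mkord xpredT (fun i => (rat_block i).[t])).
rewrite (@big_cat_nat _ _ _ M.*2 0 s) //= mulrC; congr (_ * _).
  rewrite big_nat_cond (eq_bigr (fun=> n`!%:R)) => [|i /andP[/andP[h1 h2] _]].
    by rewrite -big_nat_cond prodr_const_nat.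
  by rewrite /rat_block; case: ltnP => [|_]; [lia|case: ltnP => [|_]; [lia|rewrite hornerC]].
have M2 : (M <= M.*2)%N by lia.
rewrite (@big_cat_nat _ _ _ M 0 M.*2) //= big_split /=; congr (_ * _).
  rewrite (big_ord_mul _ M n (fun j => D%:R * t - j.+1%:R)) big_mkord.
  apply: eq_bigr => i _; rewrite /rat_block ltn_ord horner_prod.
  by apply: eq_bigr => j _; rewrite hornerD hornerZ hornerX hornerC.
rewrite (big_ord_mul _ M n (fun j => D%:R * (t + n%:R) + j.+1%:R)).
rewrite -[X in \prod_(X <= _ < _) _]add0n big_addn -addnn addKn big_mkord.
apply: eq_bigr => i _; rewrite /rat_block -addnn ltn_add2r ltn_ord addnK.
case: ltnP => [|_]; first lia.
rewrite horner_prod; apply: eq_bigr => j _.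
by rewrite hornerD hornerZ hornerX hornerC natrD natrM mulrDr addrA.
Qed.

(** At -k a non-constant block is, up to sign, a product of [n] consecutive integers, hence n! times
    a binomial coefficient. *)
Lemma rat_block_int i k : (k <= n)%N ->
  (rat_block i).[- k%:R] / n`!%:R \is a Num.int.
Proof.
move=> hk; have nf : n`!%:R != 0 :> R by rewrite pnatr_eq0 -lt0n fact_gt0.
rewrite /rat_block; case: ifP => _.
  rewrite horner_prod (eq_bigr (fun j : 'I_n => - 1 * (D * k + i * n + j.+1)%:R)) => [|j _].
    rewrite big_split /= -natr_prod prod_consecutive natrM.
    rewrite -mulrA [X in _ * (X / _)]mulrC mulfK // rpredM ?natr_int //.
    by rewrite rpred_prod // => j _; rewrite rpredN int_num1.
  rewrite hornerD hornerZ hornerX hornerC mulN1r mulrN -opprD -natrM -natrD.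
  by congr (- _%:R); lia.
case: ifP => _; last by rewrite hornerC divff ?int_num1.
rewrite horner_prod (eq_bigr (fun j : 'I_n => (D * (n - k) + (i - M) * n + j.+1)%:R)) => [|j _].
  by rewrite -natr_prod prod_consecutive natrM mulrAC divff // mul1r natr_int.
rewrite hornerD hornerZ hornerX hornerC; apply: (addrI (D * k)%:R).
have hD : (D * k <= D * n)%N by rewrite leq_mul.
have e : (D * k + (D * (n - k) + (i - M) * n + j.+1) = D * n + ((i - M) * n + j).+1)%N.
  by rewrite mulnBr; lia.
by rewrite -natrD e mulrN addrA natrM subrr add0r.
Qed.

Lemma size_rat_block i : (size (rat_block i) <= n.+1)%N.
Proof.
rewrite /rat_block; case: ifP => _.
  by apply: (@size_prod_linear _ n (fun j => _ *: 'X + (- (i * n + j).+1%:R)%:P)) => j;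
    exact: size_linear.
case: ifP => _; last by rewrite (leq_trans (size_polyC_leq1 _)).
by apply: (@size_prod_linear _ n (fun j => _ *: 'X + (D * n + ((i - M) * n + j).+1)%:R%:P)) => j;
  exact: size_linear.
Qed.

Lemma rat_fun_class : d \is a Num.int ->
  (forall j, (0 < j <= n)%N -> d / j%:R \is a Num.int) ->
  (0 < s)%N -> (M.*2 <= s)%N -> pfrac_class d n s (rat_fun D M n s).
Proof.
move=> id dd s0 Ms.
apply: (@pfrac_class_ext _ _ _ _
  (fun t => \prod_(i < s) ((rat_block i).[t] / \prod_(k < n.+1) (t + k%:R)))).
  by move=> t _; rewrite rat_block_prod.
apply: (@pfrac_class_prod _ d n id dd s
  (fun i t => (rat_block i).[t] / \prod_(k < n.+1) (t + k%:R))) => // i _.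
apply: (pfrac_class_block id); first exact: size_rat_block.
by move=> k; exact: rat_block_int.
Qed.

(** The reflection exchanges D t - j and D (t+n) + j up to sign, and the numerator is unchanged. The
    product of the n + 1 pole factors changes sign because [n] is even, and so does its power, [s]
    being odd. *)
Lemma rat_fun_sym (t : R) : odd s -> ~~ odd n -> rat_fun D M n s (- n%:R - t) = - rat_fun D M n s t.
Proof.
move=> os en; rewrite /rat_fun.
have -> : \prod_(k < n.+1) (- n%:R - t + k%:R) = - \prod_(k < n.+1) (t + k%:R).
  rewrite -!(big_mkord xpredT (fun k => _ + k%:R)) big_nat_rev /= !big_mkord.
  rewrite (eq_bigr (fun k : 'I_n.+1 => - 1 * (t + k%:R))) => [|k _].
    by rewrite big_split /= prodr_const card_ord exprS -signr_odd (negbTE en) mulr1 mulN1r.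
  rewrite add0n subSS natrB; [ring|by rewrite -ltnS].
rewrite exprNn -signr_odd os expr1 mulN1r invrN mulrN; congr (- (_ * _ / _)).
by apply: eq_bigr => j _; ring.
Qed.

(* Averaging the decomposition over t -> -n - t, at the cost of a factor 2, kills the even
   exponents (the odd [i] below) without appealing to its uniqueness. *)
Lemma rat_fun_pfrac : d \is a Num.int ->
  (forall j, (0 < j <= n)%N -> d / j%:R \is a Num.int) ->
  (M.*2 <= s)%N -> odd s -> ~~ odd n ->
  exists a : nat -> nat -> R, [/\
    forall i k, (i < s)%N -> 2 * d ^+ (s - i.+1) * a i k \is a Num.int,
    forall t, off_poles n t -> rat_fun D M n s t = pfrac s n a t &
    forall i, odd i -> \sum_(k < n.+1) a i k = 0].
Proof.
move=> id dd Ms os en; have s0 : (0 < s)%N by case: (s) os.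
have [a ia fa] := rat_fun_class id dd s0 Ms.
exists (fun i k => (a i k + (-1) ^+ i * a i (n - k)%N) / 2); split.
- move=> i k his; rewrite -mulrA mulrCA [2 * _]mulrC divfK ?pnatr_eq0 // mulrDr rpredD ?ia //.
  by rewrite mulrCA rpredM ?ia // rpredX // rpredN int_num1.
- move=> t ht.
  have ht' : off_poles n (- n%:R - t).
    move=> k hk; have -> : - n%:R - t + k%:R = - (t + (n - k)%:R) by rewrite natrB //; ring.
    by rewrite oppr_eq0 ht // leq_subr.
  have -> : rat_fun D M n s t = (rat_fun D M n s t - rat_fun D M n s (- n%:R - t)) / 2.
    by rewrite rat_fun_sym //; field.
  rewrite (fa _ ht) (fa _ ht') /pfrac -sumrB big_distrl /=; apply: eq_bigr => i _.
  rewrite [X in _ - X](reindex_inj rev_ord_inj) -sumrB big_distrl /=; apply: eq_bigr => k _.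
  have hk : (k <= n)%N by rewrite -ltnS.
  rewrite subSS (natrB _ hk) (_ : - n%:R - t + _ = - (t + k%:R)); last by ring.
  have h := ht k hk.
  have -> : (- (t + k%:R)) ^+ i.+1 = - ((-1) ^+ i * (t + k%:R) ^+ i.+1).
    by rewrite [LHS]exprNn exprS mulN1r mulNr.
  rewrite -[(-1) ^+ i]signr_odd.
  have v0 : (t + k%:R) ^+ i.+1 != 0 by rewrite expf_neq0.
  move: ((t + k%:R) ^+ i.+1) v0 => v v0.
  by case: (odd i); rewrite /= ?expr0 ?expr1 ?mulN1r ?mulr1 ?opprK ?mul1r; field; rewrite v0.
move=> i oi; rewrite -big_distrl /= big_split /= -signr_odd oi expr1.
rewrite [X in _ + X](reindex_inj rev_ord_inj) /=.
rewrite [X in _ + X](eq_bigr (fun k : 'I_n.+1 => - a i k)) => [|k _].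
  by rewrite sumrN subrr mul0r.
by rewrite mulN1r subSS subKn // -ltnS.
Qed.
End RatFun.

(** * Functions dominated by powers *)

Section PowerDominated.
Variable R : realType.
Implicit Types (x z a c : R) (f g : R -> R).

(** Weighted arithmetic-geometric mean inequality for z and 1, with weights c and 1 - c. *)
Lemma powR_le_affine z c : 0 < z -> 0 <= c <= 1 -> z `^ c <= c * z + (1 - c).
Proof.
move=> z0 /andP[c0 c1]; have m0 : 0 < c * z + (1 - c).
  have [->|cn] := eqVneq c 0; first by rewrite mul0r add0r subr0.
  by rewrite ltr_pwDl ?mulr_gt0 ?subr_ge0 // lt_neqAle eq_sym cn.
rewrite -ler_ln ?posrE ?powR_gt0 // ln_powR.
set m := c * z + _ in m0 *.
(* The bound ln u <= u - 1 is used at z/m and 1/m; weighted by c and 1 - c, its right sides add up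
   to 0. *)
have h1 : ln (z / m) <= z / m - 1.
  by rewrite -[X in ln X](subrKC 1) le_ln1Dx // ltrBrDr addNr divr_gt0.
have h2 : ln m^-1 <= m^-1 - 1.
  by rewrite -[X in ln X](subrKC 1) le_ln1Dx // ltrBrDr addNr invr_gt0.
rewrite lnM ?posrE ?invr_gt0 // in h1; rewrite !lnV ?posrE // in h1 h2.
have h3 : c * (z / m - 1) + (1 - c) * (m^-1 - 1) = 0.
  by rewrite /m; field; rewrite gt_eqF.
have := lerD (ler_wpM2l c0 h1) (ler_wpM2l (_ : 0 <= 1 - c) h2).
rewrite h3 subr_ge0 c1 => /(_ isT); move: (ln z) (ln m) => u v; lra.
Qed.

(** Bernoulli's inequality for real exponents, from the mean inequality with exponent 1/c at the
    point c z - (c - 1). *)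
Lemma affine_le_powR z c : 0 < z -> 1 <= c -> 0 < c * z - (c - 1) ->
  c * z - (c - 1) <= z `^ c.
Proof.
move=> z0 c1 m0; have c0 : 0 < c by rewrite (lt_le_trans ltr01).
have ci : 0 <= c^-1 <= 1 by rewrite invr_ge0 ltW //= invf_le1.
have := powR_le_affine m0 ci.
have -> : c^-1 * (c * z - (c - 1)) + (1 - c^-1) = z by field; rewrite gt_eqF.
move=> h; have := ge0_ler_powR (ltW c0) _ _ h.
rewrite !nnegrE powR_ge0 ltW // => /(_ isT isT).
by rewrite -powRrM mulVf ?gt_eqF // powRr1 // ltW.
Qed.

(* In the variable log x, log f lies below an affine function that it meets at log x0: this is
   how log-concavity in log x is used. *)
Definition power_dominated a x0 f : Prop :=
  exists c, forall x, a < x -> 0 <= f x <= f x0 * (x / x0) `^ c.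

Lemma power_dominated_cst a x0 c : 0 <= c -> power_dominated a x0 (fun=> c).
Proof. by move=> c0; exists 0 => x _; rewrite powRr0 mulr1 c0 lexx. Qed.

Lemma power_dominatedM a x0 f g : 0 <= a -> a < x0 ->
  power_dominated a x0 f -> power_dominated a x0 g -> power_dominated a x0 (fun x => f x * g x).
Proof.
move=> a0 ax0 [c fc] [e ge]; exists (c + e) => x ax.
have /andP[f0 f1] := fc x ax; have /andP[g0 g1] := ge x ax.
rewrite mulr_ge0 //= powRD; last first.
  by apply/implyP => _; rewrite gt_eqF // divr_gt0 // (le_lt_trans a0).
by rewrite mulrACA ler_pM.
Qed.

Lemma power_dominated_prod a x0 m (F : nat -> R -> R) : 0 <= a -> a < x0 ->
  (forall j, (j < m)%N -> power_dominated a x0 (F j)) ->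
  power_dominated a x0 (fun x => \prod_(j < m) F j x).
Proof.
move=> a0 ax0; elim: m => [|m IH] h.
  have [c hc] := power_dominated_cst a x0 (ler01 : 0 <= 1 :> R).
  by exists c => x ax; rewrite !big_ord0 hc.
have [c hc] := power_dominatedM a0 ax0 (IH (fun j hj => h j (ltnW hj))) (h m (ltnSn m)).
by exists c => x ax; rewrite !big_ord_recr hc.
Qed.

Lemma power_dominatedX a x0 f m : 0 <= a -> a < x0 ->
  power_dominated a x0 f -> power_dominated a x0 (fun x => f x ^+ m).
Proof.
move=> a0 ax0 hf.
have [c hc] := @power_dominated_prod a x0 m (fun _ => f) a0 ax0 (fun _ _ => hf).
by exists c => x ax; have := hc x ax; rewrite !prodr_const card_ord.
Qed.

(** The exponent is the derivative of log(b x - c) with respect to log x at x0. It is at least 1, so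
    Bernoulli's inequality applies. *)
Lemma power_dominated_sub a x0 b c : 0 <= a -> a < x0 -> 0 < b -> 0 <= c <= b * a ->
  power_dominated a x0 (fun x => b * x - c).
Proof.
move=> a0 ax0 b0 /andP[c0 ca]; exists (b * x0 / (b * x0 - c)) => x ax.
have pos y : a < y -> 0 < b * y - c.
  by move=> ay; rewrite subr_gt0 (le_lt_trans ca) // ltr_pM2l.
have x00 : 0 < x0 by rewrite (le_lt_trans a0).
have x1 : 0 < x by rewrite (le_lt_trans a0).
rewrite ltW ?pos //=; set e := b * x0 / (b * x0 - c).
have E : e * (x / x0) - (e - 1) = (b * x - c) / (b * x0 - c).
  by rewrite /e; field; rewrite !gt_eqF // pos.
have := @affine_le_powR (x / x0) e _ _ _.
rewrite E !divr_gt0 ?pos // ler_pdivlMr ?pos // mul1r gerBl c0 => /(_ isT isT isT).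
by rewrite ler_pdivrMr ?pos // [X in _ <= X -> _]mulrC.
Qed.

(** The derivative in log x at x0 is now -x0/(x0+b), which lies in [-1, 0]; the mean inequality is
    applied to the reciprocal. *)
Lemma power_dominated_inv a x0 b : 0 <= a -> a < x0 -> 0 <= b ->
  power_dominated a x0 (fun x => (x + b)^-1).
Proof.
move=> a0 ax0 b0; exists (- (x0 / (x0 + b))) => x ax.
have x00 : 0 < x0 by rewrite (le_lt_trans a0).
have x1 : 0 < x by rewrite (le_lt_trans a0).
have p0 : 0 < x0 + b by rewrite ltr_wpDr.
have p1 : 0 < x + b by rewrite ltr_wpDr.
rewrite invr_ge0 ltW //= powRN; set e := x0 / (x0 + b).
have z0 : 0 < x / x0 by rewrite divr_gt0.
have e0 : 0 <= e <= 1.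
  apply/andP; split; first by rewrite divr_ge0 // ltW.
  by rewrite ler_pdivrMr // mul1r lerDl.
have := powR_le_affine z0 e0.
have -> : e * (x / x0) + (1 - e) = (x + b) / (x0 + b) by rewrite /e; field; rewrite !gt_eqF.
rewrite ler_pdivlMr // => h.
by rewrite -invfM lef_pV2 ?posrE ?mulr_gt0 ?powR_gt0 // mulrC.
Qed.

(** The sign of the dominating exponent decides: (x1/x0)^c <= 1 if c >= 0, and (x2/x0)^c <= 1 if c <
    0. *)
Lemma power_dominated_quasiconcave a x0 f x1 x2 : 0 <= a -> a < x1 -> x1 <= x0 -> x0 <= x2 ->
  power_dominated a x0 f -> f x1 <= f x0 \/ f x2 <= f x0.
Proof.
move=> a0 ax1 x10 x02 [c fc].
have ax0 := lt_le_trans ax1 x10; have ax2 := lt_le_trans ax0 x02.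
have x00 : 0 < x0 by rewrite (le_lt_trans a0).
have x1p : 0 < x1 by rewrite (le_lt_trans a0).
have x2p : 0 < x2 by rewrite (le_lt_trans a0).
have /andP[f0 _] := fc x0 ax0.
have /andP[_ f1] := fc x1 ax1; have /andP[_ f2] := fc x2 ax2.
have [c0|c0] := leP 0 c; [left|right].
  apply: (le_trans f1); rewrite -[leRHS]mulr1 ler_wpM2l //.
  have -> : 1 = 1 `^ c :> R by rewrite powR1.
  rewrite ge0_ler_powR // ?nnegrE ?divr_ge0 ?ler01 ?(ltW x00) ?(ltW x1p) //.
  by rewrite ler_pdivrMr // mul1r.
apply: (le_trans f2); rewrite -[leRHS]mulr1 ler_wpM2l //.
rewrite -[c]opprK powRN invf_le1 ?powR_gt0 ?divr_gt0 //.
have -> : 1 = 1 `^ (- c) :> R by rewrite powR1.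
rewrite ge0_ler_powR // ?nnegrE ?divr_ge0 ?ler01 ?oppr_ge0 ?(ltW x00) ?(ltW x2p) ?(ltW c0) //.
by rewrite ler_pdivlMr // mul1r.
Qed.
End PowerDominated.

(** * Size of the rational function on the grid *)

Section ShiftedProducts.
Variable R : realFieldType.
Implicit Types (x u t : R).

Definition lower_prod N x : R := \prod_(j < N) (x - j.+1%:R).
Definition upper_prod N x : R := \prod_(j < N) (x + j.+1%:R).
Definition pole_prod n t : R := \prod_(k < n.+1) (t + k%:R).

Lemma lower_prod_shift N x : lower_prod N (x + 1) * (x - N%:R) = x * lower_prod N x.
Proof.
rewrite /lower_prod; elim: N => [|N IH]; first by rewrite !big_ord0 subr0 mul1r mulr1.
rewrite !big_ord_recr /= mulrA -IH (_ : x + 1 - N.+1%:R = x - N%:R); first by ring.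
by rewrite -natr1; ring.
Qed.

Lemma upper_prod_shift N u : upper_prod N (u + 1) * (u + 1) = upper_prod N u * (u + N.+1%:R).
Proof.
rewrite /upper_prod; elim: N => [|N IH]; first by rewrite !big_ord0.
by rewrite !big_ord_recr /= mulrAC IH -!natr1; ring.
Qed.

Lemma pole_prod_shift n t : pole_prod n (t + 1) * t = pole_prod n t * (t + n.+1%:R).
Proof.
have := upper_prod_shift n.+1 (t - 1); rewrite subrK.
have e y : upper_prod n.+1 (y - 1) = pole_prod n y.
  by apply: eq_bigr => k _; rewrite -natr1; ring.
by rewrite -[X in upper_prod _ X](addrK 1) !e -natr1 => ->; congr (_ * _); rewrite -natr1; ring.
Qed.

Lemma lower_prod_gt0 N x : N%:R < x -> 0 < lower_prod N x.
Proof.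
move=> h; apply: prodr_gt0 => j _; rewrite subr_gt0 (le_lt_trans _ h) //.
by rewrite ler_nat.
Qed.

Lemma upper_prod_gt0 N u : 0 <= u -> 0 < upper_prod N u.
Proof. by move=> h; apply: prodr_gt0 => j _; rewrite ltr_wpDl. Qed.

Lemma pole_prod_gt0 n t : 0 < t -> 0 < pole_prod n t.
Proof. by move=> h; apply: prodr_gt0 => j _; rewrite ltr_pwDl. Qed.

(** The shift identity gives the exact quotient (1 - 1/(x-N)) x/(x-1). Lower bounds on f(x+1) f(x-1)
    / f(x)^2 will show that the terms vary slowly near their maximum. *)
Lemma lower_prod_ratio N x : N%:R + 1 <= x -> 1 < x ->
  (1 - (x - N%:R)^-1) * lower_prod N x ^+ 2 <= lower_prod N (x + 1) * lower_prod N (x - 1).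
Proof.
move=> hx x1; have h0 := lower_prod_gt0 (_ : N%:R < x).
have {h0} p0 : 0 < lower_prod N x by apply: h0; lra.
have e1 := lower_prod_shift N x.
have e2 := lower_prod_shift N (x - 1); rewrite subrK in e2.
move: p0 e1 e2; move: (lower_prod _ _) (lower_prod _ _) (lower_prod _ _) => p_ p1 p0 hp e1 e2.
have xN : x - N%:R != 0 by rewrite gt_eqF //; lra.
have x10 : x - 1 != 0 by rewrite gt_eqF //; lra.
have -> : p1 = x * p0 / (x - N%:R) by rewrite -e1 mulfK.
have -> : p_ = p0 * (x - 1 - N%:R) / (x - 1) by rewrite e2 mulrC mulKf.
have -> : x * p0 / (x - N%:R) * (p0 * (x - 1 - N%:R) / (x - 1)) =
   (1 - (x - N%:R)^-1) * p0 ^+ 2 * (x / (x - 1)) by field; rewrite xN x10.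
rewrite -[leLHS]mulr1 ler_wpM2l //.
  by rewrite mulr_ge0 ?sqr_ge0 // subr_ge0 invf_le1; lra.
by rewrite ler_pdivlMr; lra.
Qed.

(** The exact quotient is 1 - N / ((u+N) (u+1)). *)
Lemma upper_prod_ratio N u : 1 <= u ->
  (1 - (u + 1)^-1) * upper_prod N u ^+ 2 <= upper_prod N (u + 1) * upper_prod N (u - 1).
Proof.
move=> hu; have u0 : 0 <= u by lra.
have p0 := upper_prod_gt0 N u0.
have e1 := upper_prod_shift N u.
have e2 := upper_prod_shift N (u - 1); rewrite subrK in e2.
move: p0 e1 e2; move: (upper_prod _ _) (upper_prod _ _) (upper_prod _ _) => p_ p1 p0 hp e1 e2.
have N0 : 0 <= N%:R :> R by [].
have u1 : u + 1 != 0 by rewrite gt_eqF //; lra.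
rewrite -natr1 in e1 e2.
have uN : u + N%:R != 0 by rewrite gt_eqF //; lra.
have -> : p1 = p0 * (u + (N%:R + 1)) / (u + 1) by rewrite -e1 mulfK.
have -> : p_ = p0 * u / (u + N%:R).
  by rewrite e2 (_ : u - 1 + (N%:R + 1) = u + N%:R) ?mulfK //; ring.
have -> : p0 * (u + (N%:R + 1)) / (u + 1) * (p0 * u / (u + N%:R)) =
   (1 - N%:R / (u + N%:R) * (u + 1)^-1) * p0 ^+ 2 by field; rewrite u1 uN.
rewrite ler_wpM2r ?sqr_ge0 // lerD2l lerN2 -[leRHS]mul1r ler_wpM2r ?invr_ge0; try lra.
by rewrite ler_pdivrMr; lra.
Qed.

Lemma pole_prod_ratio n t e : 0 < t - e -> 0 <= e ->
  pole_prod n (t + e) * pole_prod n (t - e) <= pole_prod n t ^+ 2.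
Proof.
move=> te e0; rewrite /pole_prod -big_split expr2 -big_split /=.
apply: ler_prod => k _; have k0 : 0 <= k%:R :> R by [].
apply/andP; split; first by rewrite mulr_ge0 //; lra.
have -> : (t + e + k%:R) * (t - e + k%:R) = (t + k%:R) * (t + k%:R) - e ^+ 2 by ring.
by rewrite gerBl sqr_ge0.
Qed.

End ShiftedProducts.

(** * Values at the grid points X / D *)

Section GridTerms.
Variables (R : realType) (D M n s : nat).
Hypotheses (D0 : (0 < D)%N) (N0 : (0 < M * n)%N).

Local Notation N := (M * n)%N.

Definition grid_fun (x : R) : R := rat_fun D M n s (x / D%:R).
Definition grid_term (X : nat) : R := grid_fun X%:R.

Lemma D_gt0 : 0 < D%:R :> R. Proof. by rewrite ltr0n. Qed.
Lemma D_neq0 : D%:R != 0 :> R. Proof. by rewrite gt_eqF ?D_gt0. Qed.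
Hint Resolve D_gt0 D_neq0 : core.

Lemma grid_funE x : grid_fun x = n`!%:R ^+ (s - M.*2) *
  (lower_prod N x * upper_prod N (x + (D * n)%:R)) / pole_prod n (x / D%:R) ^+ s.
Proof.
rewrite /grid_fun /rat_fun big_split /=; congr (_ * (_ * _) / _).
  by apply: eq_bigr => j _; rewrite mulrC divfK.
by apply: eq_bigr => j _; rewrite mulrDr mulrC divfK // natrM.
Qed.

Lemma grid_term_eq0 X : (0 < X <= N)%N -> grid_term X = 0.
Proof.
case: X => // X XN; rewrite /grid_term grid_funE /lower_prod.
by rewrite (bigD1 (Ordinal XN)) //= subrr !(mul0r, mulr0).
Qed.

Lemma grid_term_gt0 X : (N < X)%N -> 0 < grid_term X.
Proof.
move=> h; rewrite /grid_term grid_funE divr_gt0 //.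
  rewrite mulr_gt0 ?exprn_gt0 ?ltr0n ?fact_gt0 // mulr_gt0 ?lower_prod_gt0 ?ltr_nat //.
  by rewrite upper_prod_gt0 // addr_ge0.
by rewrite exprn_gt0 // pole_prod_gt0 // divr_gt0 // ltr0n (leq_trans _ h).
Qed.

Lemma grid_term_ge0 X : (0 < X)%N -> 0 <= grid_term X.
Proof.
move=> X0; case: (ltnP N X) => h; first exact/ltW/grid_term_gt0.
by rewrite grid_term_eq0 // X0 h.
Qed.

(* In the variable t (t + n), with t = X / D, every factor of the square of the term has one of
   the shapes covered by [power_dominated_sub] and [power_dominated_inv]. *)
Lemma grid_term_quasiconcave X1 X0 X2 : (N < X1)%N -> (X1 <= X0)%N -> (X0 <= X2)%N ->
  grid_term X1 <= grid_term X0 \/ grid_term X2 <= grid_term X0.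
Proof.
move=> NX1 X10 X02.
pose v (X : nat) : R := X%:R / D%:R * (X%:R / D%:R + n%:R).
(* With v = t (t+n), one has (D t - j) (D (t+n) + j) = D^2 v - j (D n + j) and (t+k) (t+n-k) = v + k
   (n-k). Squaring lets the poles k and n - k pair up. *)
pose f (x : R) : R := n`!%:R ^+ (s - M.*2) ^+ 2 *
  (\prod_(j < N) (D%:R ^+ 2 * x - j.+1%:R * (D * n + j.+1)%:R)) ^+ 2 *
  (\prod_(k < n.+1) (x + (k * (n - k))%:R)^-1) ^+ s.
have fE X : (0 < X)%N -> grid_term X ^+ 2 = f (v X).
  move=> hX; rewrite /grid_term grid_funE /f exprMn exprVn exprMn; congr (_ * _ * _).
    congr (_ ^+ 2); rewrite /lower_prod /upper_prod -big_split; apply: eq_bigr => j _ /=.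
    by rewrite /v natrD natrM; field.
  rewrite prodfV exprVn; congr (_^-1); rewrite -exprM mulnC exprM; congr (_ ^+ s); rewrite expr2.
  rewrite /pole_prod [X in X * _](reindex_inj rev_ord_inj) -big_split /=.
  apply: eq_bigr => k _; rewrite subSS; have hk : (k <= n)%N by rewrite -ltnS.
  by rewrite /v natrM natrB //; ring.
have v_le X Y : (X <= Y)%N -> v X <= v Y.
  move=> h; have h1 : X%:R / D%:R <= Y%:R / D%:R :> R by rewrite ler_pM2r ?invr_gt0 // ler_nat.
  by rewrite /v ler_pM ?addr_ge0 ?divr_ge0 // lerD2r.
have v_lt X Y : (X < Y)%N -> v X < v Y.
  move=> h; have h1 : X%:R / D%:R < Y%:R / D%:R :> R by rewrite ltr_pM2r ?invr_gt0 // ltr_nat.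
  by rewrite /v ltr_pM ?addr_ge0 ?divr_ge0 // ltrD2r.
have vN : 0 <= v N by rewrite /v mulr_ge0 ?addr_ge0 ?divr_ge0.
have vX0 : v N < v X0 by apply: v_lt; lia.
have dom : power_dominated (v N) (v X0) f.
  apply: power_dominatedM => //; first apply: power_dominatedM => //.
  - by apply: power_dominated_cst; rewrite sqr_ge0.
  - apply: power_dominatedX => //.
    apply: (@power_dominated_prod _ _ _ _ (fun j x => D%:R ^+ 2 * x - j.+1%:R * (D * n + j.+1)%:R)) => // j hj.
    apply: power_dominated_sub => //; first by rewrite exprn_gt0.
    apply/andP; split; first by rewrite -natrM.
    have -> : D%:R ^+ 2 * v N = N%:R * (D * n + N)%:R by rewrite /v natrD !natrM; field.
    by rewrite -!natrM ler_nat leq_mul // leq_add2l.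
  - apply: power_dominatedX => //.
    apply: (@power_dominated_prod _ _ _ _ (fun k x => (x + (k * (n - k))%:R)^-1)) => // k hk.
    by apply: power_dominated_inv.
have := power_dominated_quasiconcave vN (v_lt _ _ NX1) (v_le _ _ X10) (v_le _ _ X02) dom.
have X1p : (0 < X1)%N by lia.
have X0p : (0 < X0)%N by lia.
have X2p : (0 < X2)%N by lia.
rewrite -!fE // !ler_pXn2r ?nnegrE ?grid_term_ge0 //.
Qed.

(** At x = N + i + 1 the lower product loses a factor 1 - 1/(i+1), the upper product no more than
    that, and the pole product nothing. *)
Lemma grid_term_ratio i :
  (1 - i.+1%:R^-1) ^+ 2 * grid_term (N + i.+1) ^+ 2 <= grid_term (N + i.+2) * grid_term (N + i).
Proof.
rewrite /grid_term; set x : R := (N + i.+1)%:R.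
have -> : (N + i.+2)%:R = x + 1 :> R by rewrite /x !addnS natr1.
have -> : (N + i)%:R = x - 1 :> R by rewrite /x addnS -natr1 addrK.
have Nge : 1 <= N%:R :> R by rewrite ler1n.
have i0 : 0 <= i%:R :> R by [].
have xN : x - N%:R = i.+1%:R by rewrite /x natrD addrC addKr.
have hx : x = N%:R + i%:R + 1 by rewrite /x natrD -natr1 addrA.
have Dn0 : 0 <= (D * n)%:R :> R by [].
have x1 : 1 < x by lra.
have hp := @lower_prod_ratio R N x (_ : _ <= _) x1.
have {}hp := hp (ltac:(lra)); rewrite xN in hp.
have hq := @upper_prod_ratio R N (x + (D * n)%:R) (ltac:(lra)).
have Di : 0 < D%:R^-1 :> R by rewrite invr_gt0.
have xD : 0 < x / D%:R - D%:R^-1 by rewrite -[X in _ - X]mul1r -mulrBl mulr_gt0 // subr_gt0.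
have he := pole_prod_ratio n xD (ltW Di).
have a0 : 0 <= 1 - i.+1%:R^-1 :> R by rewrite subr_ge0 invf_le1 // ler1n.
have {}hq : (1 - i.+1%:R^-1) * upper_prod N (x + (D * n)%:R) ^+ 2 <=
    upper_prod N (x + (D * n)%:R + 1) * upper_prod N (x + (D * n)%:R - 1).
  apply: le_trans hq; rewrite ler_wpM2r ?sqr_ge0 // lerD2l lerN2 lef_pV2 ?posrE //; last lra.
  by rewrite -natr1; lra.
have hpq := ler_pM (mulr_ge0 a0 (sqr_ge0 _)) (mulr_ge0 a0 (sqr_ge0 _)) hp hq.
have e1p : 0 < pole_prod n (x / D%:R + D%:R^-1).
  by apply: pole_prod_gt0; rewrite addr_gt0 // divr_gt0 // (lt_trans ltr01).
have e_p : 0 < pole_prod n (x / D%:R - D%:R^-1) by exact: pole_prod_gt0.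
have e0p : 0 < pole_prod n (x / D%:R).
  by apply: pole_prod_gt0; rewrite divr_gt0 // (lt_trans ltr01).
have hes : ((pole_prod n (x / D%:R) ^+ 2) ^+ s)^-1 <=
   ((pole_prod n (x / D%:R + D%:R^-1) * pole_prod n (x / D%:R - D%:R^-1)) ^+ s)^-1.
  by rewrite lef_pV2 ?posrE ?exprn_gt0 ?mulr_gt0 // lerXn2r // nnegrE ltW // ?exprn_gt0 ?mulr_gt0.
rewrite !grid_funE ![(_ + 1) / _]mulrDl ![(_ - 1) / _]mulrBl !mul1r.
rewrite -![x + _ + (D * n)%:R]addrA ![_ + (D * n)%:R]addrC !addrA ![(D * n)%:R + x]addrC.
move: hpq hes e1p e_p e0p.
move: (pole_prod n (x / D%:R)) (pole_prod n (x / D%:R + D%:R^-1))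
  (pole_prod n (x / D%:R - D%:R^-1)) => e0 e1 e_.
move: a0; move: (1 - i.+1%:R^-1) (n`!%:R ^+ _) => a c a0.
move: (lower_prod N x) (lower_prod N (x + 1)) (lower_prod N (x - 1)) => p0 p1 p_.
move: (upper_prod N _) (upper_prod N _) (upper_prod N _) => q_ q1 q0.
move=> hpq hes e1p e_p e0p.
have -> : a ^+ 2 * (c * (p0 * q0) / e0 ^+ s) ^+ 2 =
    c ^+ 2 * ((a * p0 ^+ 2 * (a * q0 ^+ 2)) * (e0 ^+ 2) ^- s).
  have -> : (e0 ^+ 2) ^- s = (e0 ^- s) ^+ 2 by rewrite exprVn exprAC.
  by ring.
have -> : c * (p1 * q1) / e1 ^+ s * (c * (p_ * q_) / e_ ^+ s) =
    c ^+ 2 * ((p1 * p_ * (q1 * q_)) * (e1 * e_) ^- s).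
  by rewrite exprMn invfM; ring.
rewrite ler_wpM2l ?sqr_ge0 // ler_pM //.
  by rewrite mulr_ge0 // mulr_ge0 // sqr_ge0.
by rewrite invr_ge0 exprn_ge0 // sqr_ge0.
Qed.

Hypothesis DM : (D <= M)%N.

(** From x to x + 1 the lower product grows by x/(x-N) >= N/i >= 3^s, while the pole product grows
    by at most (t+n+1)/t <= 3, to be raised to the power [s]. The maximum is thus far beyond N when
    [n] is large. *)
Lemma grid_term_initial_growth i : (0 < i)%N -> (i * 3 ^ s <= N)%N ->
  grid_term (N + i) <= grid_term (N + i).+1.
Proof.
move=> i0 iN; rewrite /grid_term -natr1; set x : R := (N + i)%:R.
have n0 : (0 < n)%N by case: n N0; rewrite ?muln0.
have xp : 0 < x by rewrite ltr0n; lia.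
have xN : x - N%:R = i%:R by rewrite /x natrD addrC addKr.
have ip : 0 < i%:R :> R by rewrite ltr0n.
have Nx : N%:R < x by rewrite ltr_nat; lia.
set t := x / D%:R; have tp : 0 < t by rewrite divr_gt0.
have tn : n%:R <= t.
  rewrite /t ler_pdivlMr // -natrM ler_nat.
  by rewrite (leq_trans _ (leq_addr _ _)) // mulnC leq_mul.
have n1 : 1 <= n%:R :> R by rewrite ler1n.
rewrite !grid_funE -/t mulrDl mul1r -/t.
have hp := lower_prod_shift N x; rewrite xN in hp.
have p0 := lower_prod_gt0 Nx.
have u0 : 0 <= x + (D * n)%:R by rewrite addr_ge0 // ltW.
have q0 := upper_prod_gt0 N u0.
have hq : upper_prod N (x + (D * n)%:R) <= upper_prod N (x + 1 + (D * n)%:R).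
  apply: ler_prod => j _; apply/andP; split; first by rewrite addr_ge0.
  by rewrite lerD2r; lra.
have e0 := pole_prod_gt0 n tp.
have he : pole_prod n (t + D%:R^-1) <= 3 * pole_prod n t.
  apply: (@le_trans _ _ (pole_prod n (t + 1))).
    apply: ler_prod => k _; apply/andP; split.
      by rewrite !addr_ge0 ?invr_ge0 // ltW.
    by rewrite lerD2r lerD2l invf_le1 // ler1n.
  rewrite -(ler_pM2r tp) pole_prod_shift -natr1 mulrAC mulrC ler_wpM2r //; first exact: ltW.
  by lra.
have e1 : 0 < pole_prod n (t + D%:R^-1) by apply: pole_prod_gt0; rewrite addr_gt0 // invr_gt0.
have c0 : 0 <= n`!%:R ^+ (s - M.*2) :> R by rewrite exprn_ge0.
have iNR : i%:R * 3 ^+ s <= N%:R :> R by rewrite -natrX -natrM ler_nat.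
have {}hp : 3 ^+ s * lower_prod N x <= lower_prod N (x + 1).
  rewrite -(ler_pM2l ip) mulrA [leRHS]mulrC hp ler_wpM2r //; first exact: ltW.
  by rewrite (le_trans iNR) // ltW.
move: hp p0 hq q0 he e0 e1 c0.
move: (lower_prod _ _) (lower_prod _ _) (upper_prod _ _) (upper_prod _ _) => p1 p0 q1 q0.
move: (pole_prod n (t + D%:R^-1)) (pole_prod n t) (n`!%:R ^+ _) => e1 e0 c hp p0p hq q0p he e0p e1p c0.
rewrite -!mulrA ler_wpM2l //.
have h3 : p0 * q0 * e1 ^+ s <= p1 * q1 * e0 ^+ s.
  apply: (@le_trans _ _ (p0 * q0 * (3 * e0) ^+ s)).
    apply: ler_wpM2l; first by rewrite mulr_ge0 // ltW.
    by rewrite lerXn2r ?nnegrE ?mulr_ge0 ?(ltW e0p) ?(ltW e1p).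
  rewrite exprMn mulrA; apply: ler_wpM2r; first by rewrite exprn_ge0 // ltW.
  by rewrite [leLHS]mulrC mulrA ler_pM // ltW // mulr_gt0 // exprn_gt0.
by rewrite !mulrA ler_pdivrMr ?exprn_gt0 // [leRHS]mulrAC ler_pdivlMr ?exprn_gt0.
Qed.

Lemma fact_le_expn m : (m`! <= m ^ m)%N.
Proof.
elim: m => // m IH; rewrite factS expnS leq_mul // (leq_trans IH) //.
by case: m {IH} => // m; rewrite leq_exp2r.
Qed.

(** With t = X/D >= r n, bound the numerator products by x^N (3x)^N, n! by n^n, and the pole product
    from below by t^(n+1). This leaves (n/t)^((s-2M) n) <= r^(-(s-2M) n) and a factor t^(-s) <=
    t^(-2) that makes the terms summable. *)
Lemma grid_term_bound r X : M = (D * r)%N -> (0 < r)%N -> (M.*2 + 2 <= s)%N -> (N < X)%N ->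
  grid_term X <= ((3 * D%:R ^+ 2) ^+ M / r%:R ^+ (s - M.*2)) ^+ n * (D%:R / X%:R) ^+ 2.
Proof.
move=> Mr r0 Ms NX; rewrite /grid_term grid_funE.
have n0 : (0 < n)%N by case: n N0; rewrite ?muln0.
set x : R := X%:R; have xp : 0 < x by rewrite ltr0n; lia.
set t := x / D%:R; have tp : 0 < t by rewrite divr_gt0.
have rnX : (D * (r * n) <= X)%N by rewrite mulnA -Mr ltnW.
have nN : (D * n <= N)%N by rewrite Mr -mulnA mulnCA leq_pmull // mulnC.
have rnt : r%:R * n%:R <= t by rewrite /t ler_pdivlMr // -!natrM ler_nat mulnC.
have t1 : 1 <= t by rewrite (le_trans _ rnt) // -natrM ler1n muln_gt0 r0.
have xE : x = D%:R * t by rewrite /t mulrC divfK.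
have rp : 0 < r%:R :> R by rewrite ltr0n.
have np : 0 < n%:R :> R by rewrite ltr0n.
have hp : lower_prod N x <= x ^+ N.
  rewrite -[N in leRHS]card_ord -prodr_const; apply: ler_prod => j _.
  have jX : (j.+1 <= X)%N by have := ltn_ord j; lia.
  by rewrite subr_ge0 ler_nat jX gerBl ler0n.
have hq : upper_prod N (x + (D * n)%:R) <= (3 * x) ^+ N.
  rewrite -[N in leRHS]card_ord -prodr_const; apply: ler_prod => j _.
  apply/andP; split; first by rewrite !addr_ge0 // ltW.
  have h1 : (D * n)%:R <= x by rewrite ler_nat; lia.
  have h2 : j.+1%:R <= x by rewrite ler_nat; have := ltn_ord j; lia.
  by lra.
have he : t ^+ n.+1 <= pole_prod n t.
  rewrite -[n.+1]card_ord -prodr_const; apply: ler_prod => k _.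
  by rewrite (ltW tp) lerDl ler0n.
have hc : n`!%:R ^+ (s - M.*2) <= (n%:R ^+ n) ^+ (s - M.*2) :> R.
  by rewrite lerXn2r ?nnegrE ?exprn_ge0 // -natrX ler_nat fact_le_expn.
have p0 : 0 < lower_prod N x by apply: lower_prod_gt0; rewrite ltr_nat.
have q0 : 0 < upper_prod N (x + (D * n)%:R) by apply: upper_prod_gt0; rewrite addr_ge0 // ltW.
have e0 : 0 < pole_prod n t by exact: pole_prod_gt0.
apply: (@le_trans _ _ ((n%:R ^+ n) ^+ (s - M.*2) * (x ^+ N * (3 * x) ^+ N) / (t ^+ n.+1) ^+ s)).
  apply: ler_pM; rewrite ?mulr_ge0 ?invr_ge0 ?exprn_ge0 ?(ltW p0) ?(ltW q0) ?(ltW e0) //.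
    by apply: ler_pM; rewrite ?mulr_ge0 ?exprn_ge0 ?(ltW p0) ?(ltW q0) // ler_pM // ltW.
  by rewrite lef_pV2 ?posrE ?exprn_gt0 // lerXn2r ?nnegrE ?exprn_ge0 ?(ltW tp) ?(ltW e0).
have [k sE kE] : exists2 k, s = (M.*2 + k)%N & (s - M.*2)%N = k.
  by exists (s - M.*2)%N => //; rewrite subnKC // (leq_trans _ Ms) ?leq_addr.
rewrite kE in hc *; move: hc => _.
have -> : (n%:R ^+ n) ^+ k * (x ^+ N * (3 * x) ^+ N) / (t ^+ n.+1) ^+ s =
    ((3 * D%:R ^+ 2) ^+ M * (n%:R / t) ^+ k) ^+ n * t ^- s.
  have tN : t != 0 by rewrite gt_eqF.
  have h1 : x ^+ N * (3 * x) ^+ N = ((3 * D%:R ^+ 2) ^+ M) ^+ n * t ^+ (2 * N).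
    rewrite -exprMn (_ : x * (3 * x) = 3 * D%:R ^+ 2 * t ^+ 2); last by rewrite xE; ring.
    by rewrite exprMn [t ^+ (2 * N)]exprM [(3 * _) ^+ N]exprM.
  have h2 : (t ^+ n.+1) ^+ s = t ^+ (2 * N) * (t ^+ k) ^+ n * t ^+ s.
    by rewrite -!exprM -!exprD; congr (_ ^+ _); rewrite sE -muln2; ring.
  have h3 : ((3 * D%:R ^+ 2) ^+ M * (n%:R / t) ^+ k) ^+ n =
      ((3 * D%:R ^+ 2) ^+ M) ^+ n * ((n%:R ^+ n) ^+ k / (t ^+ k) ^+ n).
    by rewrite exprMn !expr_div_n [(n%:R ^+ k) ^+ n]exprAC.
  rewrite h1 h2 h3.
  have t2 : t ^+ (2 * N) != 0 by rewrite expf_neq0.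
  have t3 : (t ^+ k) ^+ n != 0 by rewrite !expf_neq0.
  have t4 : t ^+ s != 0 by rewrite expf_neq0.
  move: (t ^+ (2 * N)) ((t ^+ k) ^+ n) (t ^+ s) t2 t3 t4 => a b c a0 b0 c0.
  move: ((n%:R ^+ n) ^+ k) (((3 * D%:R ^+ 2) ^+ M) ^+ n) => u w.
  by field; rewrite a0 b0 c0.
have nt0 : 0 <= n%:R / t by rewrite divr_ge0 // ltW.
have hnt : (n%:R / t) ^+ k <= r%:R ^- k.
  rewrite -exprVn lerXn2r ?nnegrE ?invr_ge0 //.
  by rewrite ler_pdivrMr // mulrC ler_pdivlMr // mulrC.
have D30 : 0 <= (3 * D%:R ^+ 2) ^+ M :> R by rewrite exprn_ge0 // mulr_ge0 // exprn_ge0.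
apply: ler_pM.
- by rewrite exprn_ge0 // mulr_ge0 // exprn_ge0.
- by rewrite invr_ge0 exprn_ge0 // ltW.
- rewrite lerXn2r ?nnegrE ?mulr_ge0 ?invr_ge0 ?exprn_ge0 //.
  by rewrite ler_wpM2l.
rewrite -[D%:R / x]invf_div -/t exprVn lef_pV2 ?posrE ?exprn_gt0 //.
exact: (ler_weXn2l t1 (leq_trans (leq_addl _ _) Ms)).
Qed.
End GridTerms.

(** * Unimodal sequences *)

Section Peak.
Variables (R : realFieldType) (a : nat -> R).

Lemma finite_argmax K I : (K <= I)%N ->
  exists2 p, (K <= p <= I)%N & forall i, (K <= i <= I)%N -> a i <= a p.
Proof.
elim: I => [|I IH] KI.
  exists 0%N => [|i hi]; first by lia.
  by have -> : i = 0%N by lia.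
case: (leqP K I) => h; last first.
  by exists I.+1 => [|i hi]; [lia|have -> : i = I.+1 by lia].
have [p hp pmax] := IH h; case: (leP (a p) (a I.+1)) => c.
  exists I.+1 => [|i hi]; first by lia.
  have [->//|ne] := eqVneq i I.+1; apply: le_trans c; apply: pmax; lia.
exists p => [|i hi]; first by lia.
by have [->|ne] := eqVneq i I.+1; [exact: ltW|apply: pmax; lia].
Qed.

(** Far out the terms stay below a(K), so a maximum over a finite range starting at [K] is global;
    the initial growth covers the indices below [K]. *)
Lemma peak_exists K : 0 < a K ->
  (forall e, 0 < e -> exists I, forall i, (I <= i)%N -> a i <= e) ->
  (forall i, (i < K)%N -> a i <= a i.+1) ->
  exists2 p, (K <= p)%N & forall i, a i <= a p.
Proof.
move=> aK a0 grow; have [I hI] := a0 _ aK.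
have [p hp pmax] := @finite_argmax K (K + I) (leq_addr _ _).
have Kp : a K <= a p by apply: pmax; lia.
exists p => [|i]; first by lia.
case: (leqP i K) => [iK|Ki].
  apply: le_trans Kp; elim: K iK grow {aK hI hp pmax} => [|K IH] iK grow.
    by have -> : i = 0%N by lia.
  have [->//|ne] := eqVneq i K.+1; apply: le_trans (grow K (ltnSn K)).
  by apply: IH => [|j hj]; [lia|apply: grow; lia].
case: (leqP i (K + I)) => h; first by apply: pmax; lia.
by apply: le_trans Kp; apply: hI; lia.
Qed.

Lemma bernoulli_sub (x : R) n : 0 <= x <= 1 -> 1 - n%:R * x <= (1 - x) ^+ n.
Proof.
move=> /andP[x0 x1]; elim: n => [|n IH]; first by rewrite mul0r subr0 expr0.
rewrite exprS; apply: (@le_trans _ _ ((1 - x) * (1 - n%:R * x))); last first.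
  by rewrite ler_wpM2l // subr_ge0.
have : 0 <= n%:R * x * x by rewrite !mulr_ge0.
by rewrite -natr1; lra.
Qed.

(** Put q = (1 - 1/p)^2. Since a(p-1) <= a(p), the ratio hypothesis gives a(p+l+1) >= q^(l+1) a(p+l)
    by induction. Hence a(p+l) >= q^(l^2) a(p), and Bernoulli's inequality gives q^(l^2) >= 1 - 2
    l^2/p >= 1/2. *)
Lemma peak_width p L : (4 * L ^ 2 <= p)%N -> (2 <= p)%N ->
  (forall i, (0 < i)%N -> 0 < a i) -> (forall i, a i <= a p) ->
  (forall i, (1 - i.+1%:R^-1) ^+ 2 * a i.+1 ^+ 2 <= a i.+2 * a i) ->
  forall l, (l <= L)%N -> a p / 2 <= a (p + l).
Proof.
move=> pL p2 apos pmax ratio.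
set q : R := (1 - p%:R^-1) ^+ 2.
have p1 : 0 <= (p%:R^-1 : R) <= 1.
  by rewrite invr_ge0 ler0n invf_le1 ?ler1n ?ltr0n //; lia.
have r01 : 0 <= 1 - (p%:R^-1 : R) <= 1 by case/andP: p1 => h1 h2; lra.
have q01 : 0 <= q <= 1.
  by case/andP: r01 => h1 h2; rewrite /q exprn_ge0 //= exprn_ile1.
case/andP: (q01) => q0 q1.
have step l : q ^+ l.+1 * a (p + l) <= a (p + l).+1.
  elim: l => [|l IH].
    have h := ratio p.-1; rewrite (ltn_predK p2) in h.
    have ap1 : 0 < a p.-1 by apply: apos; lia.
    rewrite addn0 expr1 -(ler_pM2r ap1); apply: le_trans h; rewrite -/q -mulrA expr2.
    by rewrite ler_wpM2l // ler_wpM2l // ltW // apos; lia.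
  have h := ratio (p + l)%N; rewrite addnS.
  have ap1 : 0 < a (p + l)%N by apply: apos; lia.
  have ap2 : 0 < a (p + l).+1 by apply: apos.
  rewrite -(ler_pM2r ap1); apply: le_trans h.
  have -> : q ^+ l.+2 * a (p + l).+1 * a (p + l)%N =
      q * a (p + l).+1 * (q ^+ l.+1 * a (p + l)%N) by rewrite [q ^+ l.+2]exprS; ring.
  apply: (@le_trans _ _ (q * a (p + l).+1 * a (p + l).+1)).
    by rewrite ler_wpM2l // mulr_ge0 // ltW.
  rewrite -mulrA -expr2.
  rewrite ler_wpM2r ?sqr_ge0 // lerXn2r ?nnegrE ?subr_ge0 //.
  - by case/andP: p1.
  - by rewrite invf_le1 ?ler1n // ltr0n.
  - by rewrite lerD2l lerN2 lef_pV2 ?posrE ?ltr0n ?ler_nat //; lia.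
have width l : q ^+ (l ^ 2) * a p <= a (p + l).
  elim: l => [|l IH]; first by rewrite expr0 mul1r addn0.
  rewrite addnS; apply: le_trans (step l).
  apply: (@le_trans _ _ (q ^+ l.+1 * (q ^+ (l ^ 2) * a p))); last first.
    by rewrite ler_wpM2l // exprn_ge0.
  rewrite mulrA -exprD ler_wpM2r //; first by rewrite ltW // apos; lia.
  by rewrite ler_wiXn2l //; lia.
move=> l lL; apply: le_trans (width l); rewrite mulrC ler_wpM2r //.
  by rewrite ltW // apos; lia.
rewrite /q -exprM; apply: (@le_trans _ _ (1 - (2 * l ^ 2)%:R * p%:R^-1)); last exact: bernoulli_sub.
have : (2 * l ^ 2)%:R * p%:R^-1 <= 2^-1 :> R.
  rewrite ler_pdivrMr ?ltr0n; last lia.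
  rewrite ler_pdivlMl // -natrM ler_nat; nia.
by lra.
Qed.

Lemma quasiconcave_unimodal p : (0 < p)%N -> (forall i, a i <= a p) ->
  (forall i j k, (0 < i)%N -> (i <= j)%N -> (j <= k)%N -> a i <= a j \/ a k <= a j) ->
  (forall i, (0 < i < p)%N -> a i <= a i.+1) /\ (forall i, (p <= i)%N -> a i.+1 <= a i).
Proof.
move=> p0 pmax qc; split=> i hi.
  have [//|h] : a i <= a i.+1 \/ a p <= a i.+1 by apply: qc; lia.
  exact: le_trans h.
have [h|//] : a p <= a i \/ a i.+1 <= a i by apply: qc; lia.
exact: le_trans h.
Qed.

End Peak.

(** * Residue class sums of a unimodal sequence *)

Section UnimodalSums.
Variables (R : realFieldType) (b : nat -> R) (P : nat).
Hypothesis b_ge0 : forall x, 0 <= b x.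
Hypothesis b_up : forall x, (x < P)%N -> b x <= b x.+1.
Hypothesis b_down : forall x, (P <= x)%N -> b x.+1 <= b x.

(** Both the climb to b(P) and the descent after it telescope. *)
Lemma unimodal_variation T : \sum_(x < T) `|b x.+1 - b x| <= 2 * b P.
Proof.
have up x : (x <= P)%N -> \sum_(i < x) `|b i.+1 - b i| = b x - b 0%N.
  elim: x => [|x IH] h; first by rewrite big_ord0 subrr.
  rewrite big_ord_recr /= (IH (ltnW h)) ger0_norm; last by rewrite subr_ge0 b_up.
  by ring.
have down y : \sum_(i < P + y) `|b i.+1 - b i| = 2 * b P - b 0%N - b (P + y).
  elim: y => [|y IH]; first by rewrite addn0 up //; ring.
  rewrite addnS big_ord_recr /= IH ler0_norm; last by rewrite subr_le0 b_down // leq_addr.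
  by ring.
case: (leqP T P) => h.
  have mono y : (T + y <= P)%N -> b T <= b (T + y).
    elim: y => [|y IH] e; first by rewrite addn0.
    by rewrite addnS in e *; rewrite (le_trans (IH (ltnW e))) // b_up.
  rewrite up //; have := mono (P - T)%N; rewrite subnKC // => /(_ (leqnn _)).
  by have := b_ge0 0; have := b_ge0 P; lra.
rewrite -(subnKC (ltnW h)) down; have := b_ge0 0; have := b_ge0 (P + (T - P)); lra.
Qed.

(** Inside a block of length [D] two entries differ by at most the variation over that block, and
    the blocks are disjoint. *)
Lemma residue_sums_close D M j k : (j < D)%N -> (k < D)%N ->
  `|\sum_(m < M) b (m * D + j) - \sum_(m < M) b (m * D + k)| <= 2 * b P.
Proof.
move=> jD kD; apply: le_trans (unimodal_variation (M * D)).
rewrite (big_ord_mul _ _ _ (fun x => `|b x.+1 - b x|)) -sumrB.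
apply: (le_trans (ler_norm_sum _ _ _)); apply: ler_sum => m _.
have variation u v w : (v <= w)%N -> (w < D)%N ->
    `|b (u + v)%N - b (u + w)%N| <= \sum_(i < D) `|b (u + i).+1 - b (u + i)%N|.
  move=> vw wD; have -> : b (u + v)%N - b (u + w)%N = - \sum_(v <= i < w) (b (u + i).+1 - b (u + i)%N).
    rewrite (eq_bigr (fun i => b (u + i.+1)%N - b (u + i)%N)) => [|i _]; last by rewrite addnS.
    by rewrite telescope_sumr // opprB.
  rewrite normrN; apply: (le_trans (ler_norm_sum _ _ _)).
  rewrite -(big_mkord xpredT (fun i => `|b (u + i).+1 - b (u + i)%N|)).
  rewrite (@big_cat_nat _ _ _ v 0 D) //=; last by lia.
  rewrite [X in _ <= _ + X](@big_cat_nat _ _ _ w v D) //=; last by lia.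
  have s0 x y : 0 <= \sum_(x <= i < y) `|b (u + i).+1 - b (u + i)%N|.
    by apply: sumr_ge0 => i _.
  by have := s0 0%N v; have := s0 w D; lra.
case: (leqP j k) => jk; first exact: variation.
by rewrite distrC; apply: variation => //; exact: ltnW.
Qed.

End UnimodalSums.

(** * Sums over residue classes *)

Lemma sum_inv_sqr_le2 (R : realFieldType) T : \sum_(x < T) (x.+1%:R ^+ 2)^-1 <= 2 :> R.
Proof.
have h m : \sum_(x < m.+1) (x.+1%:R ^+ 2)^-1 <= 2 - m.+1%:R^-1 :> R.
  elim: m => [|m IH]; first by rewrite big_ord1 expr1n invr1; lra.
  rewrite big_ord_recr /= (le_trans (lerD IH (lexx _))) //.
  have p1 : 0 < m.+1%:R :> R by rewrite ltr0n.
  rewrite -[m.+2%:R]natr1; move: (m.+1%:R : R) p1 => z z0.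
  have z1 : 0 < z + 1 by lra.
  have -> : 2 - z^-1 + ((z + 1) ^+ 2)^-1 = 2 - (z + 1)^-1 - (z * (z + 1) ^+ 2)^-1.
    by field; rewrite !gt_eqF.
  by rewrite gerBl invr_ge0 mulr_ge0 ?exprn_ge0 // ltW.
case: T => [|m]; first by rewrite big_ord0.
by apply: (le_trans (h m)); rewrite gerBl invr_ge0.
Qed.

Lemma ler_sum_ord (R : numDomainType) (b : nat -> R) u v :
  (forall x, 0 <= b x) -> (u <= v)%N -> \sum_(x < u) b x <= \sum_(x < v) b x.
Proof.
move=> b0 uv; rewrite -!(big_mkord xpredT b) [leRHS](@big_cat_nat _ _ _ u) //=.
by rewrite lerDl sumr_ge0.
Qed.

Section GridSums.
Variables (R : realType) (D r s T : nat).
Hypotheses (D0 : (0 < D)%N) (r0 : (0 < r)%N) (Ms : ((D * r).*2 + 2 <= s)%N).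

Local Notation M := (D * r)%N.

(** The constant b in the bound O(b^n) on the linear form. *)
Definition decay_rate : R := (3 * D%:R ^+ 2) ^+ M / r%:R ^+ (s - M.*2).

(* The shift makes the residue classes of the grid points 1, ..., D modulo D those of 0, ..., D - 1. *)
Definition grid_seq n x : R := grid_term R D M n s x.+1.

Lemma decay_rate_ge0 : 0 <= decay_rate.
Proof. by rewrite divr_ge0 ?exprn_ge0 // mulr_ge0 ?exprn_ge0. Qed.

Lemma grid_seq_ge0 n x : (0 < n)%N -> 0 <= grid_seq n x.
Proof. by move=> n0; apply: grid_term_ge0; rewrite // !muln_gt0 D0 r0. Qed.

Lemma grid_seq_le n x : (0 < n)%N ->
  grid_seq n x <= decay_rate ^+ n * D%:R ^+ 2 / x.+1%:R ^+ 2.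
Proof.
move=> n0; have N0 : (0 < M * n)%N by rewrite !muln_gt0 D0 r0.
have [h|h] := leqP x.+1 (M * n).
  rewrite /grid_seq grid_term_eq0 // divr_ge0 ?exprn_ge0 //.
  by rewrite mulr_ge0 ?exprn_ge0 ?decay_rate_ge0.
rewrite -mulrA -expr_div_n.
exact: (grid_term_bound R D0 N0 (leq_pmulr _ r0) erefl r0 Ms h).
Qed.

Lemma grid_seq_sum_le n m : (0 < n)%N ->
  \sum_(x < m) grid_seq n x <= 2 * D%:R ^+ 2 * decay_rate ^+ n.
Proof.
move=> n0; apply: (@le_trans _ _ (\sum_(x < m) decay_rate ^+ n * D%:R ^+ 2 * (x.+1%:R ^+ 2)^-1)).
  by apply: ler_sum => x _; exact: grid_seq_le.
rewrite -mulr_sumr (_ : 2 * _ * _ = decay_rate ^+ n * D%:R ^+ 2 * 2); last by ring.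
by rewrite ler_wpM2l ?sum_inv_sqr_le2 // mulr_ge0 ?exprn_ge0 ?decay_rate_ge0.
Qed.

(** Class sums differ by at most twice the peak value, while for large [n] the peak is so wide that
    the whole sum reaches any prescribed multiple [T] of it. This is what makes the class sums
    asymptotically equal. *)
Lemma grid_seq_peak : exists n0, forall n, (n0 <= n)%N -> exists2 mx : R, 0 < mx &
  (forall j k Q, (j < D)%N -> (k < D)%N ->
    `|\sum_(m < Q) grid_seq n (m * D + j) - \sum_(m < Q) grid_seq n (m * D + k)| <= 2 * mx) /\
  exists Q0, forall Q, (Q0 <= Q)%N -> T%:R * mx <= \sum_(x < Q * D) grid_seq n x.
Proof.
(* The 2T + 1 terms from the peak on, each at least half of it, add up to more than T times it; [K]
   is the peak position that [peak_width] requires for this width. *)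
pose L := T.*2; pose K := (4 * L ^ 2 + 2)%N.
(* Then i 3^s <= N for all i < K, so that the terms increase up to index [K] past N. *)
exists (K * 3 ^ s + 1)%N => n hn.
have n0 : (0 < n)%N by lia.
pose N := (M * n)%N; have N0 : (0 < N)%N by rewrite !muln_gt0 D0 r0.
have nN : (n <= N)%N by rewrite leq_pmull // muln_gt0 D0.
have DM : (D <= M)%N by rewrite leq_pmulr.
pose a i : R := grid_term R D M n s (N + i).
have aE i : a i.+1 = grid_seq n (N + i) by rewrite /a addnS.
have apos i : (0 < i)%N -> 0 < a i by move=> i0; apply: grid_term_gt0; rewrite // -/N; lia.
have a00 : a 0%N = 0 by rewrite /a addn0 grid_term_eq0 // N0 leqnn.
have avan e : 0 < e -> exists I, forall i, (I <= i)%N -> a i <= e.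
  move=> e0; pose c := decay_rate ^+ n * D%:R ^+ 2.
  have c0 : 0 <= c by rewrite mulr_ge0 ?exprn_ge0 ?decay_rate_ge0.
  exists (Num.bound (c / e)).+1 => -[//|i]; rewrite ltnS => hi; rewrite aE.
  apply: (le_trans (grid_seq_le _ n0)); rewrite -/c ler_pdivrMr ?exprn_gt0 // mulrC -ler_pdivrMr //.
  apply: (@le_trans _ _ ((N + i).+1%:R)).
    apply: (@le_trans _ _ (Num.bound (c / e))%:R).
      by rewrite ltW // archi_boundP // divr_ge0 // ltW.
    by rewrite ler_nat; lia.
  by rewrite expr2 ler_peMr // ler1n.
have grow i : (i < K)%N -> a i <= a i.+1.
  case: i => [|i] hi; first by rewrite a00 ltW // apos.
  rewrite {2}/a addnS; apply: grid_term_initial_growth => //.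
  apply: leq_trans nN; apply: leq_trans hn.
  by apply: (@leq_trans (K * 3 ^ s)); rewrite ?leq_addr // leq_mul2r ltnW ?orbT.
have K0 : (0 < K)%N by rewrite /K addn2.
have [p Kp pmax] := peak_exists (apos _ K0) avan grow.
have qc i j k : (0 < i)%N -> (i <= j)%N -> (j <= k)%N -> a i <= a j \/ a k <= a j.
  move=> i0 ij jk; apply: grid_term_quasiconcave; rewrite // -/N; lia.
have p0 : (0 < p)%N by exact: leq_trans Kp.
have [up down] := quasiconcave_unimodal p0 pmax qc.
have width := @peak_width R a p L _ _ apos pmax _.
have {}width : forall l, (l <= L)%N -> a p / 2 <= a (p + l)%N.
  apply: width; [rewrite /K in Kp; lia|rewrite /K in Kp; lia|].
  by move=> i; exact: grid_term_ratio.
have pE : p = p.-1.+1 by rewrite prednK.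
(* [grid_seq] is shifted by one, so the peak a(p) sits at N + p - 1. *)
pose P := (N + p.-1)%N.
have bP : grid_seq n P = a p by rewrite -aE -pE.
exists (a p); first exact: apos.
have b0 x := grid_seq_ge0 x n0.
split=> [j k Q jD kD|].
  rewrite -bP; apply: residue_sums_close => // x hx.
    have [h|h] := ltnP x N; first by rewrite {1}/grid_seq grid_term_eq0 ?b0.
    have xE : x = (N + (x - N))%N by lia.
    rewrite xE -addnS -!aE; apply: up; rewrite /P in hx; lia.
  have xE : x = (N + (x - N))%N by rewrite /P in hx; lia.
  by rewrite xE -addnS -!aE; apply: down; rewrite /P in hx; lia.
exists (P + L.+1)%N => Q hQ.
apply: (@le_trans _ _ (\sum_(x < P + L.+1) grid_seq n x)); last first.
  by apply: ler_sum_ord => //; rewrite (leq_trans hQ) // leq_pmulr.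
rewrite big_split_ord /=; apply: (@le_trans _ _ (\sum_(i < L.+1) grid_seq n (P + i))); last first.
  by rewrite lerDr sumr_ge0.
apply: (@le_trans _ _ (\sum_(i < L.+1) a p / 2)); last first.
  apply: ler_sum => i _; rewrite /P -addnA -aE -addSn -pE; apply: width.
  by rewrite -ltnS.
have LE : L.+1%:R = 2 * T%:R + 1 :> R by rewrite -natr1 /L -mul2n natrM.
rewrite sumr_const card_ord -[_ *+ L.+1]mulr_natl LE.
by have := apos p p0; have : 0 <= T%:R :> R by []; lra.
Qed.
End GridSums.

Local Open Scope classical_set_scope.

(** * Limits of the linear forms *)

Section Limits.
Variable R : realType.
Implicit Types (u v : nat -> R) (l y z : R).

Lemma cvg_eq u v l : (forall n, u n = v n) -> u @ \oo --> l -> v @ \oo --> l.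
Proof. by move=> /funext ->. Qed.

Lemma cvg_mull c u l : u @ \oo --> l -> (fun n => c * u n) @ \oo --> c * l.
Proof. by move=> h; apply: cvgM => //; exact: cvg_cst. Qed.

Lemma cvg_mull0 c u : u @ \oo --> (0 : R) -> (fun n => c * u n) @ \oo --> (0 : R).
Proof. by move=> h; have := @cvg_mull c _ _ h; rewrite mulr0. Qed.

Lemma cvg_sum_ord m (F : nat -> nat -> R) (l : nat -> R) :
  (forall i, (i < m)%N -> F i @ \oo --> l i) ->
  (fun n => \sum_(i < m) F i n) @ \oo --> \sum_(i < m) l i.
Proof.
elim: m => [|m IH] h.
  rewrite big_ord0; apply: (@cvg_eq (fun=> 0)) => [n|]; last exact: cvg_cst.
  by rewrite big_ord0.
rewrite big_ord_recr; apply: (@cvg_eq (fun n => \sum_(i < m) F i n + F m n)) => [n|].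
  by rewrite big_ord_recr.
by apply: cvgD; [apply: IH => i hi; apply: h; lia|apply: h].
Qed.

Lemma cvg_sum_ord0 m (F : nat -> nat -> R) :
  (forall i, (i < m)%N -> F i @ \oo --> (0 : R)) ->
  (fun n => \sum_(i < m) F i n) @ \oo --> (0 : R).
Proof.
by move=> h; have := @cvg_sum_ord m F (fun=> 0) h; rewrite big1.
Qed.

Lemma cvg_exp e u l : u @ \oo --> l -> (fun n => u n ^+ e) @ \oo --> l ^+ e.
Proof.
move=> h; elim: e => [|e IH].
  by apply: (@cvg_eq (fun=> 1)) => [n|]; [rewrite expr0|rewrite expr0; exact: cvg_cst].
by rewrite exprS; apply: (@cvg_eq (fun n => u n * u n ^+ e)) => [n|]; [rewrite exprS|exact: cvgM].
Qed.

Lemma cvg_inv_shift z : 0 < z -> (fun n => (n%:R + z)^-1) @ \oo --> (0 : R).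
Proof.
move=> z0; apply: (@squeeze_cvgr _ _ _ _ (fun=> 0) (fun n => (1 + z^-1) * harmonic n)).
- apply: nearW => n; have nz : 0 < n%:R + z by rewrite ltr_wpDl.
  rewrite invr_ge0 ltW //= /harmonic /= ler_pdivlMr ?ltr0n // mulrC ler_pdivrMr //.
  rewrite -natr1 mulrDl mul1r mulrDr mulVf ?gt_eqF // addrA.
  have : 0 <= z^-1 * n%:R by rewrite mulr_ge0 ?invr_ge0 ?(ltW z0).
  by lra.
- exact: cvg_cst.
- by apply: cvg_mull0; exact: cvg_harmonic.
Qed.

Lemma cvg_inv_shift_exp z e : 0 < z -> (fun n => (n%:R + z) ^- e.+1) @ \oo --> (0 : R).
Proof.
move=> z0; have := @cvg_exp e.+1 _ _ (cvg_inv_shift z0); rewrite expr0n /=.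
by apply: cvg_eq => n; rewrite exprVn.
Qed.

Lemma zeta_cvg k : (2 <= k)%N ->
  (fun n => \sum_(x < n) (x.+1%:R ^+ k)^-1) @ \oo --> zeta R k.
Proof.
move=> k2; have E n : series (fun n : nat => (n.+1%:R ^+ k)^-1 : R) n = \sum_(x < n) (x.+1%:R ^+ k)^-1.
  by rewrite /series /= big_mkord.
apply: (@cvg_eq (series (fun n : nat => (n.+1%:R ^+ k)^-1 : R))) => [n|]; first exact: E.
apply: nondecreasing_is_cvgn => [a b ab|].
  by rewrite !E; apply: (@ler_sum_ord _ (fun x => (x.+1%:R ^+ k)^-1)).
exists 2 => _ [n _ <-]; rewrite E; apply: le_trans (sum_inv_sqr_le2 R n).
apply: ler_sum => x _; rewrite lef_pV2 ?posrE ?exprn_gt0 ?ltr0n //.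
by rewrite ler_weXn2l ?ler1n.
Qed.

Lemma zeta_cvg_mul k c : (2 <= k)%N -> (0 < c)%N ->
  (fun n => \sum_(x < c * n) (x.+1%:R ^+ k)^-1) @ \oo --> zeta R k.
Proof.
move=> k2 c0.
exact: (@cvg_comp _ _ _ (fun n => c * n)%N
  (fun n => \sum_(x < n) (x.+1%:R ^+ k)^-1 : R) _ _ _ (cvg_mulnl _ c0) (zeta_cvg k2)).
Qed.

End Limits.

(** * Linear forms in zeta values as limits of dyadic sums *)

Section LinearForm.
Variables (R : realType) (m n s : nat) (w : nat -> R) (a : nat -> nat -> R).

Definition dyadic_form (f : R -> R) (Q : nat) : R :=
  \sum_(l < m.+1) w l * \sum_(j < 2 ^ l) \sum_(q < Q) f (q%:R + j.+1%:R / (2 ^ l)%:R).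

(** Up to the factor W(2^(i+1)), the coefficient of zeta(i+1) in the linear form; for i = 0 it is
    the sum of the residues. *)
Definition pfrac_residue (i : nat) : R := \sum_(k < n.+1) a i k.

(** Collects the first k terms lost when a sum of (q + k + y)^(-i-1) over q is replaced by the one
    without k. *)
Definition dyadic_rational_part : R :=
  \sum_(l < m.+1) w l * \sum_(j < 2 ^ l) \sum_(i < s) \sum_(k < n.+1)
    a i k * \sum_(q < k) (q%:R + j.+1%:R / (2 ^ l)%:R) ^- i.+1.

(** The inner sum is W(2^(i+1)). The term i = 0 contains the meaningless [zeta R 1]; its coefficient
    will vanish. *)
Definition dyadic_limit : R :=
  \sum_(i < s) pfrac_residue i * (\sum_(l < m.+1) w l * (2 ^+ i.+1) ^+ l) * zeta R i.+1
  - dyadic_rational_part.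

Lemma sum_shift (F : nat -> R) k Q :
  \sum_(q < Q) F (q + k)%N = \sum_(q < Q) F q - \sum_(q < k) F q + \sum_(q < k) F (Q + q)%N.
Proof.
have h1 : \sum_(q < k + Q) F q = \sum_(q < k) F q + \sum_(q < Q) F (q + k)%N.
  by rewrite big_split_ord /=; congr (_ + _); apply: eq_bigr => q _; rewrite addnC.
have h2 : \sum_(q < k + Q) F q = \sum_(q < Q) F q + \sum_(q < k) F (Q + q)%N.
  by rewrite addnC big_split_ord.
by rewrite h1 in h2; rewrite addrAC -h2; ring.
Qed.

(** The points of the double sum are the fractions (x+1)/2^l with x < 2^l Q, each taken once. *)
Lemma dyadic_power_sum l e Q :
  \sum_(j < 2 ^ l) \sum_(q < Q) (q%:R + j.+1%:R / (2 ^ l)%:R) ^- e =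
  (2 ^+ e) ^+ l * \sum_(x < 2 ^ l * Q) (x.+1%:R ^+ e)^-1 :> R.
Proof.
rewrite exchange_big mulnC /= (big_ord_mul _ _ _ (fun x => (x.+1%:R ^+ e)^-1)) mulr_sumr.
apply: eq_bigr => q _; rewrite mulr_sumr; apply: eq_bigr => j _.
have h : (2 ^ l)%:R != 0 :> R by rewrite pnatr_eq0 -lt0n expn_gt0.
have -> : q%:R + j.+1%:R / (2 ^ l)%:R = (q * 2 ^ l + j).+1%:R / (2 ^ l)%:R :> R.
  by rewrite -addnS natrD natrM mulrDl mulfK.
by rewrite expr_div_n invf_div natrX [(2 ^+ e) ^+ l]exprAC.
Qed.

(** Removing the shift by k from each partial fraction subtracts k initial terms and adds k terms
    beyond Q. The three pieces are partial sums of zeta values, the rational part, and a tail that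
    tends to 0. *)
Lemma dyadic_form_pfrac Q : dyadic_form (pfrac s n a) Q =
  \sum_(i < s) pfrac_residue i * \sum_(l < m.+1) w l *
     ((2 ^+ i.+1) ^+ l * \sum_(x < 2 ^ l * Q) (x.+1%:R ^+ i.+1)^-1)
  - dyadic_rational_part
  + \sum_(l < m.+1) w l * \sum_(j < 2 ^ l) \sum_(i < s) \sum_(k < n.+1)
    a i k * \sum_(q < k) (Q%:R + (q%:R + j.+1%:R / (2 ^ l)%:R)) ^- i.+1.
Proof.
have -> : \sum_(i < s) pfrac_residue i * \sum_(l < m.+1) w l *
     ((2 ^+ i.+1) ^+ l * \sum_(x < 2 ^ l * Q) (x.+1%:R ^+ i.+1)^-1) =
  \sum_(l < m.+1) w l * \sum_(j < 2 ^ l) \sum_(i < s) \sum_(k < n.+1)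
     a i k * \sum_(q < Q) (q%:R + j.+1%:R / (2 ^ l)%:R) ^- i.+1.
  under eq_bigr do rewrite mulr_sumr.
  rewrite exchange_big /=; apply: eq_bigr => l _; rewrite exchange_big mulr_sumr /=.
  apply: eq_bigr => i _; rewrite mulrCA -dyadic_power_sum; congr (_ * _).
  by rewrite mulr_sumr; apply: eq_bigr => j _; rewrite /pfrac_residue mulr_suml.
rewrite /dyadic_rational_part -sumrB -big_split; apply: eq_bigr => l _ /=.
rewrite -mulrBr -mulrDr; congr (_ * _); rewrite -sumrB -big_split; apply: eq_bigr => j _ /=.
rewrite /pfrac exchange_big -sumrB -big_split; apply: eq_bigr => i _ /=.
rewrite exchange_big -sumrB -big_split; apply: eq_bigr => k _ /=.
rewrite -mulrBr -mulrDr -mulr_sumr; congr (_ * _).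
set y := j.+1%:R / _.
rewrite (eq_bigr (fun q : 'I_Q => ((q + k)%N%:R + y) ^- i.+1)) => [|q _]; last first.
  by rewrite natrD addrAC.
rewrite (sum_shift (fun q => (q%:R + y) ^- i.+1)); congr (_ + _).
by apply: eq_bigr => q _; rewrite natrD addrA.
Qed.

Lemma dyadic_form_cvg : pfrac_residue 0 = 0 ->
  dyadic_form (pfrac s n a) @ \oo --> dyadic_limit.
Proof.
move=> rho0; apply: (cvg_eq (fun Q => esym (dyadic_form_pfrac Q))).
rewrite /dyadic_limit -[_ - _]addr0; apply: cvgD; first apply: cvgB.
- under [X in _ --> X]eq_bigr do rewrite -mulrA.
  apply: (@cvg_sum_ord R s (fun i Q => pfrac_residue i * \sum_(l < m.+1) w l *
     ((2 ^+ i.+1) ^+ l * \sum_(x < 2 ^ l * Q) (x.+1%:R ^+ i.+1)^-1))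
     (fun i => pfrac_residue i * ((\sum_(l < m.+1) w l * (2 ^+ i.+1) ^+ l) * zeta R i.+1))).
  (* For i = 0 the harmonic sums diverge; the vanishing sum of residues removes them. *)
  case=> [_|i hi].
    rewrite rho0 mul0r; apply: (@cvg_eq _ (fun=> 0)) => [Q|]; last exact: cvg_cst.
    by rewrite mul0r.
  apply: cvg_mull; rewrite mulr_suml.
  under [X in _ --> X]eq_bigr do rewrite -mulrA.
  apply: (@cvg_sum_ord R m.+1 (fun l Q => w l *
     ((2 ^+ i.+2) ^+ l * \sum_(x < 2 ^ l * Q) (x.+1%:R ^+ i.+2)^-1))
     (fun l => w l * ((2 ^+ i.+2) ^+ l * zeta R i.+2))) => l _.
  by apply: cvg_mull; apply: cvg_mull; apply: zeta_cvg_mul; rewrite ?expn_gt0.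
- exact: cvg_cst.
apply: (@cvg_sum_ord0 R m.+1 (fun l Q => w l * \sum_(j < 2 ^ l) \sum_(i < s) \sum_(k < n.+1)
    a i k * \sum_(q < k) (Q%:R + (q%:R + j.+1%:R / (2 ^ l)%:R)) ^- i.+1)) => l _.
apply: cvg_mull0.
apply: (@cvg_sum_ord0 R (2 ^ l)%N (fun j Q => \sum_(i < s) \sum_(k < n.+1)
    a i k * \sum_(q < k) (Q%:R + (q%:R + j.+1%:R / (2 ^ l)%:R)) ^- i.+1)) => j _.
apply: (@cvg_sum_ord0 R s (fun i Q => \sum_(k < n.+1)
    a i k * \sum_(q < k) (Q%:R + (q%:R + j.+1%:R / (2 ^ l)%:R)) ^- i.+1)) => i _.
apply: (@cvg_sum_ord0 R n.+1 (fun k Q =>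
    a i k * \sum_(q < k) (Q%:R + (q%:R + j.+1%:R / (2 ^ l)%:R)) ^- i.+1)) => k _.
apply: cvg_mull0.
apply: (@cvg_sum_ord0 R k (fun q Q => (Q%:R + (q%:R + j.+1%:R / (2 ^ l)%:R)) ^- i.+1)) => q _.
by apply: cvg_inv_shift_exp; rewrite ltr_wpDl // divr_gt0 ?ltr0n // expn_gt0.
Qed.

End LinearForm.

(** * Integrality *)

Section Integrality.
Variables (R : realType) (m n s : nat) (w : nat -> R) (a : nat -> nat -> R) (d : R).
Hypothesis w_int : forall l, w l \is a Num.int.
Hypothesis a_int : forall i k, (i < s)%N -> 2 * d ^+ (s - i.+1) * a i k \is a Num.int.
Hypothesis d_div : forall x, (0 < x <= 2 ^ m * n)%N -> d / x%:R \is a Num.int.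

(** Each term is a numerator times (2^l/x)^(i+1) with x a positive integer. Of d^s, the part
    d^(s-i-1) serves the numerator and d^(i+1) clears x^(i+1). *)
Lemma dyadic_rational_part_int : 2 * d ^+ s * dyadic_rational_part m n s w a \is a Num.int.
Proof.
rewrite /dyadic_rational_part mulr_sumr rpred_sum // => l _.
rewrite mulrCA rpredM // mulr_sumr rpred_sum // => j _.
rewrite mulr_sumr rpred_sum // => i _; rewrite mulr_sumr rpred_sum // => k _.
rewrite !mulr_sumr rpred_sum // => q _.
have hl : (2 ^ l)%:R != 0 :> R by rewrite pnatr_eq0 -lt0n expn_gt0.
have -> : q%:R + j.+1%:R / (2 ^ l)%:R = (q * 2 ^ l + j).+1%:R / (2 ^ l)%:R :> R.
  by rewrite -addnS natrD natrM mulrDl mulfK.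
(* As q < k <= n, the integer x is at most (q+1) 2^l <= 2^m n, within the range covered by
   [d_div]. *)
have hx : (q * 2 ^ l + j.+1 <= 2 ^ m * n)%N.
  apply: (@leq_trans (q.+1 * 2 ^ l)); first by rewrite mulSn addnC leq_add2r.
  rewrite mulnC leq_mul ?leq_exp2l // -ltnS //.
  by rewrite (leq_ltn_trans (ltn_ord q)).
have -> : d ^+ s = d ^+ (s - i.+1) * d ^+ i.+1 by rewrite -exprD subnK.
set x : R := (q * 2 ^ l + j).+1%:R; set c : R := (2 ^ l)%:R.
have x0 : x != 0 by rewrite pnatr_eq0.
have -> : 2 * (d ^+ (s - i.+1) * d ^+ i.+1) * (a i k * (x / c) ^- i.+1) =
   (2 * d ^+ (s - i.+1) * a i k) * (c * (d / x)) ^+ i.+1.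
  rewrite -[(x / c) ^- _]exprVn invf_div !exprMn; ring.
rewrite rpredM ?a_int // rpredX // rpredM ?natr_int //.
by apply: d_div; rewrite -addnS hx addnS.
Qed.

Lemma pfrac_residue_int i : d \is a Num.int -> (i < s)%N ->
  2 * d ^+ s * pfrac_residue n a i \is a Num.int.
Proof.
move=> id his; rewrite /pfrac_residue mulr_sumr rpred_sum // => k _.
have -> : d ^+ s = d ^+ (s - i.+1) * d ^+ i.+1 by rewrite -exprD subnK.
have -> : 2 * (d ^+ (s - i.+1) * d ^+ i.+1) * a i k =
   (2 * d ^+ (s - i.+1) * a i k) * d ^+ i.+1 by ring.
by rewrite rpredM ?a_int // rpredX.
Qed.

End Integrality.

(** * Vanishing of the sum of the residues *)

Section GridForm.
Variables (R : realType) (m r s n : nat).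
Local Notation D := (2 ^ m)%N.
Local Notation M := (D * r)%N.
Hypotheses (r0 : (0 < r)%N) (Ms : (M.*2 + 2 <= s)%N) (n0 : (0 < n)%N).

Let D0 : (0 < D)%N. Proof. by rewrite expn_gt0. Qed.
Let D00 : D%:R != 0 :> R. Proof. by rewrite pnatr_eq0 -lt0n. Qed.

(** The limit of t R(t) along t = 1, 2, 3, ... is computed twice: the partial fractions give the sum
    of the residues, and the bound O(1/t^2) on R gives 0. *)
Lemma pfrac_residue0 (a : nat -> nat -> R) :
  (forall t, off_poles n t -> rat_fun D M n s t = pfrac s n a t) -> pfrac_residue n a 0 = 0.
Proof.
move=> fa.
pose u (Q : nat) : R := Q.+1%:R * rat_fun D M n s Q.+1%:R.
have u0 : u @ \oo --> (0 : R).
  pose c := decay_rate R D r s ^+ n * D%:R ^+ 2.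
  apply: (@squeeze_cvgr _ _ _ _ (fun=> 0) (fun Q => c * harmonic Q)).
  - apply: nearW => Q.
    have : rat_fun D M n s (Q.+1%:R : R) = grid_seq R D r s n (Q.+1 * D).-1.
      rewrite /grid_seq /grid_term /grid_fun prednK ?muln_gt0 //.
      by rewrite natrM mulfK.
    move=> e; rewrite /u e mulr_ge0 ?grid_seq_ge0 //=.
    have X0 : (0 < Q.+1 * D)%N by rewrite muln_gt0.
    have Q0 : 0 < Q.+1%:R :> R by rewrite ltr0n.
    have c0 : 0 <= c by rewrite mulr_ge0 ?exprn_ge0 // decay_rate_ge0.
    have h := @grid_seq_le R D r s D0 r0 Ms n (Q.+1 * D).-1 n0.
    rewrite prednK // -/c in h.
    apply: (@le_trans _ _ (Q.+1%:R * (c / Q.+1%:R ^+ 2))).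
      rewrite ler_wpM2l //; apply: (le_trans h); rewrite ler_wpM2l //.
      rewrite lef_pV2 ?posrE ?exprn_gt0 ?ltr0n // lerXn2r ?nnegrE // ler_nat.
      by rewrite leq_pmulr.
    rewrite /harmonic /= expr2 invfM [leLHS]mulrC -!mulrA mulVf ?mulr1 //.
  - exact: cvg_cst.
  - by apply: cvg_mull0; exact: cvg_harmonic.
have u1 : u @ \oo --> pfrac_residue n a 0.
  have s0 : (0 < s)%N by rewrite (leq_trans _ Ms) // addn2.
  have E Q : \sum_(i < s) \sum_(k < n.+1) a i k * (Q.+1%:R / (Q.+1%:R + k%:R) ^+ i.+1) = u Q.
    rewrite /u fa => [|k _]; last by rewrite -natrD pnatr_eq0 addSn.
    rewrite /pfrac mulr_sumr; apply: eq_bigr => i _; rewrite mulr_sumr.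
    by apply: eq_bigr => k _; rewrite mulrCA.
  have -> : pfrac_residue n a 0 = \sum_(i < s) if (i : nat) == 0%N then pfrac_residue n a 0 else 0.
    rewrite (bigD1 (Ordinal s0)) //= big1 ?addr0 // => i hi.
    by rewrite -val_eqE /= in hi; rewrite (negbTE hi).
  apply: (cvg_eq E).
  apply: (@cvg_sum_ord R s (fun i Q => \sum_(k < n.+1) a i k * (Q.+1%:R / (Q.+1%:R + k%:R) ^+ i.+1))
    (fun i => if i == 0%N then pfrac_residue n a 0 else 0)) => i _.
  have one k : (fun Q => Q.+1%:R / (Q.+1%:R + k%:R) : R) @ \oo --> (1 : R).
    have h : (fun Q => 1 - k%:R * (Q%:R + k.+1%:R)^-1 : R) @ \oo --> (1 - 0 : R).
      apply: cvgB; first exact: cvg_cst.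
      by apply: cvg_mull0; apply: cvg_inv_shift; rewrite ltr0n.
    rewrite subr0 in h; apply: cvg_eq h => Q.
    have p : Q%:R + k.+1%:R != 0 :> R by rewrite -natrD pnatr_eq0 addnS.
    rewrite -[Q.+1%:R]natr1 -[k.+1%:R]natr1 in p *.
    by field; rewrite addrAC -addrA.
  have pw k e : (fun Q => (Q.+1%:R + k%:R) ^- e.+1 : R) @ \oo --> (0 : R).
    have k1 : 0 < k.+1%:R :> R by rewrite ltr0n.
    apply: cvg_eq (cvg_inv_shift_exp e k1) => Q.
    by rewrite -natrD addnS -addSn natrD.
  case: i => [|i] /=.
    apply: (@cvg_sum_ord R n.+1 (fun k Q => a 0%N k * (Q.+1%:R / (Q.+1%:R + k%:R) ^+ 1)) (a 0%N)) => k _.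
    by rewrite -[a 0%N k in X in _ --> X]mulr1; apply: cvg_mull; exact: one.
  apply: (@cvg_sum_ord0 R n.+1 (fun k Q => a i.+1 k * (Q.+1%:R / (Q.+1%:R + k%:R) ^+ i.+2))) => k _.
  apply: cvg_mull0; rewrite -(mulr0 1).
  apply: (@cvg_eq _ (fun Q => (Q.+1%:R / (Q.+1%:R + k%:R)) * (Q.+1%:R + k%:R) ^- i.+1)) => [Q|].
    by rewrite [_ ^+ i.+2]exprS invfM mulrA.
  exact: cvgM.
exact: (cvg_unique _ u1 u0).
Qed.
End GridForm.

(** * Bounds for the linear forms *)

Section FormBounds.
Variables (R : realType) (m r s : nat) (w : nat -> R).
Local Notation D := (2 ^ m)%N.
Local Notation M := (D * r)%N.
Hypotheses (r0 : (0 < r)%N) (Ms : (M.*2 + 2 <= s)%N).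

Let D0 : (0 < D)%N. Proof. by rewrite expn_gt0. Qed.

(** The total absolute weight of the form, which involves 2^l residue class sums at level l. *)
Definition weight_norm : R := \sum_(l < m.+1) `|w l| * (2 ^ l)%:R.

Lemma weight_norm_ge0 : 0 <= weight_norm.
Proof. by apply: sumr_ge0 => l _; rewrite mulr_ge0. Qed.

(** The point (j+1)/2^l is the grid point (j+1) 2^(m-l) / D; the predecessor matches the shift in
    [grid_seq]. *)
Lemma dyadic_index_lt l j : (l <= m)%N -> (j < 2 ^ l)%N -> ((j.+1 * 2 ^ (m - l)).-1 < D)%N.
Proof.
move=> lm jl; rewrite -subn1 ltn_subLR; last by rewrite muln_gt0 expn_gt0.
by rewrite add1n ltnS -[in X in (_ <= X)%N](subnKC lm) expnD leq_mul2r jl orbT.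
Qed.

Lemma dyadic_form_grid n Q : dyadic_form m w (rat_fun D M n s) Q =
  \sum_(l < m.+1) w l * \sum_(j < 2 ^ l) \sum_(q < Q)
    grid_seq R D r s n (q * D + (j.+1 * 2 ^ (m - l)).-1)%N.
Proof.
apply: eq_bigr => l _; congr (_ * _); apply: eq_bigr => j _; apply: eq_bigr => q _.
rewrite /grid_seq /grid_term /grid_fun; congr (rat_fun _ _ _ _ _).
rewrite -addnS prednK ?muln_gt0 ?expn_gt0 //.
have lm : (l <= m)%N by rewrite -ltnS.
have h1 : (2 ^ l)%:R != 0 :> R by rewrite pnatr_eq0 -lt0n expn_gt0.
have h2 : (2 ^ (m - l))%:R != 0 :> R by rewrite pnatr_eq0 -lt0n expn_gt0.
have DE : D%:R = (2 ^ l)%:R * (2 ^ (m - l))%:R :> R by rewrite -natrM -expnD subnKC.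
rewrite !(natrD, natrM) DE.
by field; rewrite h1 h2.
Qed.

(** Replacing every class sum by that of class 0 turns the form into W(2) times this sum, with an
    error of at most 2 [weight_norm] peak values. As |W(2)| >= 1 and the class sum exceeds 2
    [weight_norm] + 1 peak values, one peak value is a lower bound uniform in [Q]. *)
Lemma dyadic_form_bounds : 1 <= `|\sum_(l < m.+1) w l * 2 ^+ l| ->
  exists n0, forall n, (n0 <= n)%N -> exists mx : R, exists Q0 : nat,
    0 < mx /\ forall Q, (Q0 <= Q)%N ->
    mx <= `|dyadic_form m w (rat_fun D M n s) Q|
       <= weight_norm * (2 * D%:R ^+ 2 * decay_rate R D r s ^+ n).
Proof.
move=> W1; pose B := (Num.bound (2 * weight_norm + 1)).
have BC : 2 * weight_norm + 1 < B%:R.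
  by rewrite archi_boundP // addr_ge0 // mulr_ge0 // weight_norm_ge0.
(* The total is at most D times (the sum of class 0 plus 2 peak values), so a total of D (2 + B)
   peak values leaves B of them for class 0. *)
have [n0 h] := @grid_seq_peak R D r s (D * (2 + B))%N D0 r0 Ms.
exists n0.+1 => n hn; have [mx mx0 [hclose [Q0 hbig]]] := h n (ltnW hn).
have n1 : (0 < n)%N by case: (n) hn.
exists mx, Q0; split=> // Q hQ; rewrite dyadic_form_grid.
pose rs x := \sum_(q < Q) grid_seq R D r s n (q * D + x)%N.
pose S := \sum_(x < Q * D) grid_seq R D r s n x.
have SE : S = \sum_(x < D) rs x.
  by rewrite /S (big_ord_mul _ _ _ (grid_seq R D r s n)) exchange_big.
have b0 x : 0 <= grid_seq R D r s n x by exact: grid_seq_ge0.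
have rs0 x : 0 <= rs x by apply: sumr_ge0.
have rsS x : (x < D)%N -> rs x <= S.
  by move=> xD; rewrite SE (bigD1 (Ordinal xD)) //= lerDl sumr_ge0.
have Sle : S <= D%:R * (rs 0%N + 2 * mx).
  rewrite SE mulr_natl -[D in leRHS]card_ord -sumr_const; apply: ler_sum => x _.
  have := hclose x 0%N Q (ltn_ord x) D0; rewrite -/(rs x) -/(rs 0%N) ler_norml; lra.
have {}hbig : (D * (2 + B))%:R * mx <= S by exact: hbig.
have Dp : 0 < D%:R :> R by rewrite ltr0n.
have rs_big : B%:R * mx <= rs 0%N.
  have := le_trans hbig Sle; rewrite natrM -mulrA ler_pM2l // natrD mulrDl; lra.
pose idx l j := (j.+1 * 2 ^ (m - l)).-1.
have F : \sum_(l < m.+1) w l * \sum_(j < 2 ^ l) rs (idx l j) =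
    (\sum_(l < m.+1) w l * 2 ^+ l) * rs 0%N +
    \sum_(l < m.+1) w l * \sum_(j < 2 ^ l) (rs (idx l j) - rs 0%N).
  rewrite mulr_suml -big_split; apply: eq_bigr => l _ /=.
  by rewrite sumrB sumr_const card_ord -[rs 0%N *+ _]mulr_natl natrX; ring.
have E1 : `|\sum_(l < m.+1) w l * \sum_(j < 2 ^ l) (rs (idx l j) - rs 0%N)| <=
    weight_norm * (2 * mx).
  apply: (le_trans (ler_norm_sum _ _ _)); rewrite /weight_norm mulr_suml.
  apply: ler_sum => l _; rewrite normrM -mulrA ler_wpM2l //.
  apply: (le_trans (ler_norm_sum _ _ _)).
  rewrite [leRHS]mulr_natl -[X in _ *+ X]card_ord -sumr_const; apply: ler_sum => j _.
  by apply: hclose; rewrite // dyadic_index_lt // -ltnS.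
apply/andP; split.
  rewrite -/(\sum_(l < m.+1) w l * \sum_(j < 2 ^ l) rs (idx l j)) F.
  move: E1; set W := \sum_(l < _) w l * 2 ^+ l in W1 F *; set X := \sum_(l < _) _ => E1.
  have h1 : `|W * rs 0%N| <= `|W * rs 0%N + X| + `|X|.
    by rewrite -{1}[W * rs 0%N](addrK X); exact: ler_normB.
  have h2 : B%:R * mx <= `|W * rs 0%N|.
    rewrite normrM (ger0_norm (rs0 _)); apply: (le_trans rs_big).
    by rewrite ler_peMl.
  have h3 : (2 * weight_norm + 1) * mx <= B%:R * mx by rewrite ler_pM2r // ltW.
  by rewrite mulrDl mul1r in h3; lra.
have SU : S <= 2 * D%:R ^+ 2 * decay_rate R D r s ^+ n by exact: grid_seq_sum_le.
apply: (le_trans (ler_norm_sum _ _ _)).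
apply: (@le_trans _ _ (weight_norm * S)); last by rewrite ler_wpM2l ?weight_norm_ge0.
rewrite /weight_norm mulr_suml; apply: ler_sum => l _; rewrite normrM -mulrA ler_wpM2l //.
apply: (le_trans (ler_norm_sum _ _ _)).
rewrite [leRHS]mulr_natl -[X in _ *+ X]card_ord -sumr_const; apply: ler_sum => j _.
rewrite -/(rs (idx l j)) ger0_norm // rsS // dyadic_index_lt // -ltnS //.
Qed.
End FormBounds.

(** * Passage to the limit and clearing of denominators *)

Section Arithmetic.
Variable R : realType.

Lemma cvg_norm_bounds (u : nat -> R) l lo hi Q0 : u @ \oo --> l ->
  (forall Q, (Q0 <= Q)%N -> lo <= `|u Q| <= hi) -> lo <= `|l| <= hi.
Proof.
move=> /cvg_norm ul h.
have cv : cvgn (fun Q => `|u Q|) by apply/cvg_ex; exists `|l|.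
rewrite -(cvg_lim _ ul) //; apply/andP; split.
  by apply: limr_ge => //; exists Q0 => // Q /h /andP[].
by apply: limr_le => //; exists Q0 => // Q /h /andP[].
Qed.

Lemma common_denominator (f : nat -> R) N : exists2 q : nat, (0 < q)%N &
  forall j, (j <= N)%N -> rational (f j) -> q%:R * f j \is a Num.int.
Proof.
have one (x : R) : exists2 q : nat, (0 < q)%N & rational x -> q%:R * x \is a Num.int.
  case: (pselect (rational x)) => [[y _ <-]|nx]; last by exists 1%N.
  exists `|denq y|%N; first by rewrite absz_gt0 denq_neq0.
  move=> _; rewrite natr_absz ger0_norm ?denq_ge0 // /ratr mulrC divfK ?intr_int //.
  by rewrite intr_eq0 denq_neq0.
elim: N => [|N [q q0 IH]].
  by have [q q0 h] := one (f 0%N); exists q => // j; rewrite leqn0 => /eqP ->.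
have [p p0 h] := one (f N.+1); exists (q * p)%N; first by rewrite muln_gt0 q0.
move=> j jN rj; rewrite natrM; have [jE|ne] := eqVneq j N.+1.
  by rewrite jE in rj *; rewrite -mulrA rpredM ?natr_int ?h.
by rewrite mulrAC rpredM ?natr_int ?IH //; lia.
Qed.

End Arithmetic.

(** * Infinitely many irrational odd zeta values *)

Section ManyIrrational.
Variables (R : realType) (m : nat).
Local Notation D := (2 ^ m)%N.
Local Notation r := (2 * 4 ^ D)%N.
Local Notation M := (D * r)%N.

(* Chosen so that, with r = 2 * 4^D, one has (4^D)^s * decay_rate = decay_base^M / 2^s. *)
Definition decay_base : nat := (3 * D ^ 2 * r ^ 2)%N.
(** The first summand gives s > M [decay_base], so that 2^s absorbs the power [decay_base]^M; the
    others make N > m. *)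
Definition zeta_range : nat := (M * decay_base + m + 1)%N.
Local Notation N := zeta_range.
Local Notation s := (2 * N + 1)%N.

Let D0 : (0 < D)%N. Proof. by rewrite expn_gt0. Qed.
Let r0 : (0 < r)%N. Proof. by rewrite muln_gt0 expn_gt0. Qed.

Lemma decay_base_gt0 : (0 < decay_base)%N.
Proof.
have h u v : (0 < u)%N -> (0 < v)%N -> (0 < 3 * u ^ 2 * v ^ 2)%N.
  by move=> u0 v0; rewrite !muln_gt0 ?expn_gt0 ?u0 ?v0.
exact: h.
Qed.

Lemma pole_order_bound : (M.*2 + 2 <= s)%N.
Proof.
have : (M <= M * decay_base)%N by rewrite leq_pmulr // decay_base_gt0.
rewrite /zeta_range; move: (M * decay_base)%N (M) => a b; lia.
Qed.

(** Once the powers of r cancel, it remains to see that 2 [decay_base]^M <= 2^s, which follows from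
    [decay_base] < 2^[decay_base] and s > M [decay_base]. *)
Lemma decay_rate_beats_denominator :
  (4 ^+ D) ^+ s * decay_rate R D r s <= 2^-1.
Proof.
have Ms := pole_order_bound.
have [k sE kE] : exists2 k, s = (M.*2 + k)%N & (s - M.*2)%N = k.
  by exists (s - M.*2)%N => //; rewrite subnKC // (leq_trans _ Ms) ?leq_addr.
rewrite /decay_rate kE.
have rp : r%:R != 0 :> R by rewrite pnatr_eq0 -lt0n.
have fp : 4 ^+ D != 0 :> R by rewrite expf_neq0 // pnatr_eq0.
have rE : r%:R = 2 * 4 ^+ D :> R by rewrite natrM natrX.
have -> : (4 ^+ D) ^+ s * ((3 * D%:R ^+ 2) ^+ M / r%:R ^+ k) = decay_base%:R ^+ M / 2 ^+ s :> R.
  have -> : (4 ^+ D) ^+ s = r%:R ^+ s / 2 ^+ s :> R.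
    by rewrite rE exprMn mulrAC divff ?mul1r // expf_neq0 // pnatr_eq0.
  have -> : r%:R ^+ s = (r%:R ^+ 2) ^+ M * r%:R ^+ k :> R.
    by rewrite [in LHS]sE exprD -[X in _ ^+ X * _]mul2n exprM.
  have dbE : decay_base%:R = 3 * D%:R ^+ 2 * r%:R ^+ 2 :> R.
    have h u v : (3 * u ^ 2 * v ^ 2)%:R = 3 * u%:R ^+ 2 * v%:R ^+ 2 :> R.
      by rewrite 2!natrM !natrX.
    exact: h.
  rewrite dbE [(3 * _ * _) ^+ M]exprMn.
  have rk : r%:R ^+ k != 0 :> R by rewrite expf_neq0.
  have sp : 2 ^+ s != 0 :> R by rewrite expf_neq0 // pnatr_eq0.
  move: (r%:R ^+ k) (2 ^+ s) ((r%:R ^+ 2) ^+ M) ((3 * D%:R ^+ 2) ^+ M) rk sp => x y z v x0 y0.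
  by field; rewrite x0 y0.
rewrite ler_pdivrMr ?exprn_gt0 // mulrC ler_pdivlMr // -natrX -natrM -natrX ler_nat.
apply: (@leq_trans (2 ^ (decay_base * M) * 2)).
  have M0 : (0 < M)%N by rewrite muln_gt0 D0.
  rewrite (expnM 2 decay_base) leq_mul // leq_exp2r //.
  by apply: ltnW; exact: ltn_expl.
rewrite -expnSr leq_exp2l // /zeta_range mulnC; move: (M * decay_base)%N => a; lia.
Qed.

Definition irrational_indices : seq nat :=
  [seq j <- iota 1 N | `[< irrational (zeta R (2 * j + 1)) >] ].

Lemma many_irrational : (m < size irrational_indices)%N.
Proof.
rewrite ltnNge; apply/negP => Im.
pose W : {poly R} := \prod_(j <- irrational_indices) ('X - ((2 ^ (2 * j + 1))%:R)%:P).
have sW : (size W <= m.+1)%N by rewrite /W size_prod_XsubC.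
pose w l := W`_l.
have WE x : \sum_(l < m.+1) w l * x ^+ l = W.[x] by rewrite (horner_coef_wide _ sW).
have w_int l : w l \is a Num.int.
  have WZ : W = map_poly intr (\prod_(j <- irrational_indices) ('X - ((2 ^ (2 * j + 1))%N%:Z)%:P)).
    rewrite rmorph_prod; apply: eq_bigr => j _.
    by rewrite rmorphB /= map_polyX map_polyC /= pmulrn.
  by rewrite /w WZ coef_map intr_int.
have W_int x : x \is a Num.int -> W.[x] \is a Num.int.
  by move=> hx; rewrite -WE rpred_sum // => l _; rewrite rpredM ?w_int // rpredX.
(* The roots are 2^(2j+1) with j >= 1, hence at least 8. *)
have W2 : W.[2] != 0.
  rewrite /W horner_prod prodf_seq_neq0; apply/allP => j; rewrite mem_filter mem_iota => /andP[_ hj].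
  rewrite /= hornerXsubC subr_eq0 eqr_nat neq_ltn -[in X in (X < _)%N](expn1 2) ltn_exp2l //.
  by rewrite addn1 ltnS muln_gt0; case/andP: hj => ->.
have W2ge : 1 <= `|\sum_(l < m.+1) w l * 2 ^+ l|.
  by rewrite WE norm_intr_ge1 // W_int // natr_int.
have Ms := pole_order_bound.
have [n0 hn0] := dyadic_form_bounds r0 Ms W2ge.
have [q q0 hq] := common_denominator (fun j => zeta R (2 * j + 1)) N.
set C := weight_norm m w in hn0.
have C0 : 0 <= C by exact: weight_norm_ge0.
(* With n = 2^e > e, both [n0] and the constant 4 q C D^2 lie below n, and n < 2^n then makes the
   final bound less than 1. *)
pose e := (n0 + Num.bound (4 * q%:R * C * D%:R ^+ 2)).+1.
pose n := (2 ^ e)%N.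
have en : (e < n)%N by rewrite ltn_expl.
have n1 : (0 < n)%N by rewrite expn_gt0.
have [mx [Q0 [mx0 hmx]]] := hn0 n (ltac:(lia)).
pose d : R := (lcm_upto (D * n))%:R.
have d_int : d \is a Num.int by exact: natr_int.
have d_div x : (0 < x <= D * n)%N -> d / x%:R \is a Num.int.
  move=> hx; have /dvdnP[y yE] := dvdn_lcm_upto hx.
  rewrite /d yE natrM mulfK ?natr_int // pnatr_eq0 -lt0n; by case/andP: hx.
(* D n = 2^(m+e) is a power of two, so [lcm_upto_pow2] applies. *)
have d_le : d <= (4 ^+ D) ^+ n.
  by rewrite /d /n -expnD -!natrX ler_nat -expnM -expnD lcm_upto_pow2.
have os : odd s by rewrite oddD oddM.
have on : ~~ odd n by rewrite oddX.
have M2s : (M.*2 <= s)%N by rewrite (leq_trans _ Ms) ?leq_addr.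
have d_div' x : (0 < x <= n)%N -> d / x%:R \is a Num.int.
  by move=> /andP[x0 xn]; apply: d_div; rewrite x0 (leq_trans xn) // leq_pmull.
have [a [a_int fa a_odd]] := rat_fun_pfrac D d_int d_div' M2s os on.
have res0 := pfrac_residue0 r0 Ms n1 fa.
have lim := @dyadic_form_cvg R m n s w a res0.
have formE Q : dyadic_form m w (pfrac s n a) Q = dyadic_form m w (rat_fun D M n s) Q.
  apply: eq_bigr => l _; congr (_ * _); apply: eq_bigr => j _; apply: eq_bigr => x _.
  have jp : 0 < j.+1%:R / (2 ^ l)%:R :> R by rewrite divr_gt0 ?ltr0n // expn_gt0.
  by rewrite fa // => k _; rewrite gt_eqF // ltr_pwDl // ltr_wpDl.
have {}lim := cvg_eq formE lim.
have /andP[lo hi] := cvg_norm_bounds lim hmx.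
set L := dyadic_limit m n s w a in lo hi lim.
have L0 : 0 < `|L| by exact: lt_le_trans lo.
have L_int : q%:R * (2 * d ^+ s) * L \is a Num.int.
  rewrite /L /dyadic_limit mulrBr rpredB //; last first.
    by rewrite -mulrA rpredM ?natr_int // (dyadic_rational_part_int w_int a_int d_div).
  rewrite mulr_sumr rpred_sum // => -[i hi'] _ /=.
  (* Even exponents i + 1 disappear by symmetry and i = 0 by [res0]; an irrational zeta(i+1) is
     killed by the root 2^(i+1) of W, and a rational one is cleared by [q]. *)
  have [oi|ei] := boolP (odd i).
    by rewrite /pfrac_residue a_odd // !(mul0r, mulr0) int_num0.
  have iE : i = (2 * i./2)%N :> nat by rewrite mul2n even_halfK.
  have [i0|i0] := eqVneq (i./2) 0%N.
    by rewrite iE i0 muln0 res0 !(mul0r, mulr0) int_num0.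
  have iN : (i./2 <= N)%N by move: hi'; rewrite {1}iE addn1 ltnS leq_pmul2l.
  have res_int := pfrac_residue_int n a_int d_int hi'.
  rewrite WE; have zE : i.+1 = (2 * i./2 + 1)%N by rewrite addn1; congr _.+1.
  have [irr|rat] := pselect (irrational (zeta R (2 * i./2 + 1))).
    have -> : W.[2 ^+ i.+1] = 0.
      apply/eqP; rewrite /W horner_prod prodf_seq_eq0; apply/hasP; exists i./2.
        by rewrite mem_filter mem_iota asboolT //= lt0n i0 add1n ltnS iN.
      by rewrite /= hornerXsubC natrX -zE subrr.
    by rewrite !(mul0r, mulr0) int_num0.
  have {}rat : rational (zeta R (2 * i./2 + 1)) by apply: contrapT.
  have -> : q%:R * (2 * d ^+ s) * (pfrac_residue n a i * W.[2 ^+ i.+1] * zeta R i.+1) =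
     (2 * d ^+ s * pfrac_residue n a i) * W.[2 ^+ i.+1] * (q%:R * zeta R (2 * i./2 + 1)).
    by rewrite zE; ring.
  apply: rpredM; last exact: hq.
  by apply: rpredM; [exact: res_int|apply: W_int; rewrite rpredX // natr_int].
have dp : 0 < d by rewrite ltr0n lcm_upto_gt0.
have qp : 0 < q%:R :> R by rewrite ltr0n.
have c0 : 0 < q%:R * (2 * d ^+ s) by rewrite !mulr_gt0 // exprn_gt0.
have L_ge1 : 1 <= `|q%:R * (2 * d ^+ s) * L|.
  by rewrite norm_intr_ge1 // mulf_neq0 ?(gt_eqF c0) // -normr_gt0.
rewrite normrM gtr0_norm // in L_ge1.
set beta := decay_rate R D r s in hi.
have beta0 : 0 <= beta by exact: decay_rate_ge0.
have B0 : 0 <= 4 * q%:R * C * D%:R ^+ 2 by rewrite !mulr_ge0 ?exprn_ge0 // ltW.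
have key : q%:R * (2 * d ^+ s) * `|L| <= 4 * q%:R * C * D%:R ^+ 2 * 2^-1 ^+ n.
  apply: (@le_trans _ _ (q%:R * (2 * ((4 ^+ D) ^+ n) ^+ s) * (C * (2 * D%:R ^+ 2 * beta ^+ n)))).
    apply: ler_pM => //; first exact: ltW.
    rewrite ler_wpM2l ?(ltW qp) // ler_wpM2l // lerXn2r ?nnegrE ?exprn_ge0 ?(ltW dp) //.
  have -> : q%:R * (2 * ((4 ^+ D) ^+ n) ^+ s) * (C * (2 * D%:R ^+ 2 * beta ^+ n)) =
     4 * q%:R * C * D%:R ^+ 2 * ((4 ^+ D) ^+ s * beta) ^+ n.
    by rewrite [(_ * beta) ^+ n]exprMn [((4 ^+ D) ^+ n) ^+ s]exprAC; move: (_ ^+ n) (beta ^+ n) => u v; ring.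
  rewrite ler_wpM2l // lerXn2r ?nnegrE ?mulr_ge0 ?exprn_ge0 ?invr_ge0 //.
  exact: decay_rate_beats_denominator.
have small : 4 * q%:R * C * D%:R ^+ 2 * 2^-1 ^+ n < 1.
  rewrite exprVn ltr_pdivrMr ?exprn_gt0 // mul1r.
  apply: (@lt_trans _ _ n%:R); last by rewrite -natrX ltr_nat ltn_expl.
  apply: (lt_le_trans (archi_boundP B0)); rewrite ler_nat.
  by apply: (leq_trans _ (ltnW en)); rewrite /e ltnW // ltnS leq_addl.
by have := le_lt_trans (le_trans L_ge1 key) small; rewrite ltxx.
Qed.

End ManyIrrational.

(* From the count of irrational values to subsets *)
Local Close Scope ring_scope.
Local Open Scope card_scope.

Theorem mainTheorem5 (R : realType) (m : nat) :
  exists N : nat, (m < N)%N /\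
    forall A : set R,
      A `<=` odd_zeta_values R N -> A #= `I_(N - m)%N ->
      exists x : R, A x /\ irrational x.
Proof.
have mN : (m < zeta_range m)%N by rewrite /zeta_range addn1 ltnS leq_addl.
exists (zeta_range m); split => // A Avals Acard; apply: contrapT => noirr.
pose f j := zeta R (2 * j + 1)%N.
(* The indices of the rational values. More than m of the N indices give irrational values, so fewer
   than N - m remain, too few to cover [A]. *)
pose t := [seq j <- iota 1 (zeta_range m) | ~~ `[< irrational (f j) >] ].
have At : A `<=` (fun i => f (nth 0%N t i)) @` `I_(size t).
  move=> x Ax; have [j /= jN jx] := Avals _ Ax.
  have jt : j \in t.
    rewrite mem_filter mem_iota add1n ltnS jN andbT; apply/asboolPn => irr.
    by apply: noirr; exists x; rewrite -jx in Ax *.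
  by exists (index j t); rewrite /= ?index_mem // nth_index.
have := card_le_trans (subset_card_le At) (card_image_le _ _).
rewrite (card_le_eql Acard) card_le_II leqNgt => /negP; apply.
rewrite ltn_subRL -[X in (_ < X)%N](size_iota 1) -(count_predC (fun j => `[< irrational (f j) >]) (iota 1 _)).
by rewrite -!size_filter ltn_add2r (many_irrational R m).
Qed.
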